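(* Let $Z\subset\mathbb PU$ be a smooth non-degenerate linearly normal projective variety with $Z\ne\mathbb PU$, and assume that $\partial^0:\partial^{-1}(\Xi_Z^0)\to\Xi_Z^0$ is surjective. Then either $Z\subset\mathbb PU$ is Euler-symmetric, or the restriction $$\partial^0:\widetilde U\cap\partial^{-1}(\Xi_Z^0)\longrightarrow\Xi_Z^0$$ is an isomorphism. In particular, if (for $Z$ smooth, non-degenerate, linearly normal, $Z\neq\mathbb PU$) $\widetilde U\cap\partial^{-1}(\Xi_Z^0)=0$, then $\partial^0$ is surjective if and only if one of the following occurs: (i) $Z\subset\mathbb PU$ is tangentially non-degenerate; (ii) $Z\subset\mathbb PU$ is Euler-symmetric and tangentially non-degenerate, and the first prolongation $\hat{\mathfrak g}^{(1)}=(\mathrm{Sym}^2U^\vee\otimes U)\cap\mathrm{Hom}(U,\hat{\mathfrak g})$ is nonzero; (iii) $Z\subset\mathbb PU$ is Euler-symmetric with $\hat{\mathfrak g}^{(1)}=0$, moreover the map $\theta:\partial^{-1}(\Xi^0_Z)\to U^\vee$ is an isomorphism, and $\wedge_Z^2\cong\mathbb C$ is one-dimensional.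
   Context: Everything is over $\mathbb C$; varieties are irreducible. $\hat Z\subset U$ is the affine cone, $\hat z$ a nonzero vector on the line $z$, $\widehat T_zZ\subset U$ the affine tangent space, $\hat{\mathfrak g}=\mathfrak{aut}(\hat Z)=\{A\in\mathrm{End}(U):A(\hat z)\in\widehat T_zZ\ \forall z\in Z\}$. Linearly normal means $H^0(Z,\mathcal O_Z(1))=U^\vee$. For $h\in\mathrm{Hom}(U,\hat{\mathfrak g})$ write $h(u,v)=h(u)(v)$. $\partial:\mathrm{Hom}(U,\hat{\mathfrak g})\to\mathrm{Hom}(\wedge^2U,U)$, $\partial h(u_1,u_2)=h(u_1)(u_2)-h(u_2)(u_1)$. $\wedge^2_Z=\{w\in\wedge^2U^\vee:w(\hat z,\widehat T_zZ)=0\ \forall z\in Z\}$; $Z$ is tangentially non-degenerate if $\wedge_Z^2=0$. $\Xi_Z=\{\sigma\in\mathrm{Hom}(\wedge^2U,U):\sigma(\hat z,\widehat T_zZ)\subset\widehat T_zZ\ \forall z\in Z\}$, $\Xi^0_Z=\{\sigma\in\mathrm{Hom}(\wedge^2U,U):\sigma(\hat z,\widehat T_zZ)=0\ \forall z\in Z\}=\wedge_Z^2\otimes U$; $\partial^0$ is the restriction of $\partial$ to $\partial^{-1}(\Xi_Z^0)$. Every $h\in\partial^{-1}(\Xi_Z)$ satisfies $h(u,u)\in\mathbb Cu$ for all $u\in\hat Z$, and $\theta(h)\in H^0(Z,\mathcal O_Z(1))=U^\vee$ is defined by $h(u,u)=\theta(h)(u)\,u$ for $u\in\hat Z$. $\widetilde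 U=\{h\in\mathrm{Hom}(U,\hat{\mathfrak g}): h(u)(u)=0,\ h(u)(\widehat T_{[u]}Z)\subset\mathbb Cu\ \forall u\in\hat Z\}$. $Z\subset\mathbb PU$ is Euler-symmetric if for a general point $x\in Z$ there is a $\mathbb C^*$-action on $Z$, induced by a multiplicative subgroup of $GL(U)$, fixing $x$ and whose isotropy action on $T_xZ$ is by scalar multiplication (the standard weight-one Euler action). *)

(* Defs.v *)
(* The complex numbers are R[i] for R : realType; everything below makes sense
   over any algebraically closed field K. *)
From HB Require Import structures.
From mathcomp Require Import all_boot all_order all_algebra.
From mathcomp Require Import mpoly.
From mathcomp Require Import boolp classical_sets functions reals complex.

Set Implicit Arguments.
Unset Strict Implicit.
Unset Printing Implicit Defensive.

Import GRing.Theory.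

Local Open Scope ring_scope.
Local Open Scope classical_set_scope.

Section LinearAlgebra.
Variables (K : fieldType) (V W : vectType K).

Definition has_vdim (P : set V) (d : nat) : Prop :=
  exists S : {vspace V}, (forall v, v \in S <-> P v) /\ \dim S = d.

Definition is_linear_iso (A : set V) (B : set W) (f : V -> W) : Prop :=
  set_bij A B f /\
  forall (a : K) (x y : V), A x -> A y -> f (a *: x + y) = a *: f x + f y.

End LinearAlgebra.

Section ProjectiveVarieties.
Variables (K : closedFieldType) (n : nat).
Local Notation U := 'rV[K]_n.

Definition peval (p : {mpoly K[n]}) (u : U) : K := p.@[fun i => u 0 i].

Definition pdiff (p : {mpoly K[n]}) (u v : U) : K :=
  \sum_(i < n) peval p^`M(i) u * v 0 i.

(* A subset Z of the projective space PU of lines in U is represented by the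
   set of all nonzero vectors lying on the lines of Z, so [Z u] says that
   u != 0 and [u] belongs to Z.  The affine cone is Z together with 0. *)
Definition projective_space : set U := [set u | u != 0].

Definition affine_cone (Z : set U) : set U := [set u | u = 0 \/ Z u].

Definition proj_closed (Z : set U) : Prop :=
  exists S : set {mpoly K[n]},
    (forall p, S p -> exists d : nat, p \is d.-homog) /\
    (forall u, Z u <-> u != 0 /\ forall p, S p -> peval p u = 0).

Definition proj_variety (Z : set U) : Prop :=
  [/\ proj_closed Z, Z !=set0 &
      forall A B : set U, proj_closed A -> proj_closed B ->
        Z `<=` A `|` B -> Z `<=` A \/ Z `<=` B].

Definition variety_chain (Z : set U) (d : nat) (c : nat -> set U) : Prop :=
  (forall i, (i <= d)%N -> proj_variety (c i) /\ c i `<=` Z) /\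
  (forall i, (i < d)%N -> c i `<` c i.+1).

(* Krull dimension of a projective variety *)
Definition proj_dim (Z : set U) (d : nat) : Prop :=
  (exists c, variety_chain Z d c) /\ ~ (exists c, variety_chain Z d.+1 c).

(* Zariski tangent space, at the vector z, of the affine cone over Z *)
Definition affine_tangent (Z : set U) (z : U) : set U :=
  [set v | forall p : {mpoly K[n]},
             (forall u, affine_cone Z u -> peval p u = 0) -> pdiff p z v = 0].

(* The (projective) tangent space of Z at [z] is the quotient of the affine one
   by the line [z], whence the shift by one in dimensions. *)
Definition smooth_variety (Z : set U) : Prop :=
  exists2 d : nat, proj_dim Z d &
    forall z, Z z -> has_vdim (affine_tangent Z z) d.+1.

Definition nondegenerate_variety (Z : set U) : Prop :=
  forall f : 'Hom(U, K^o), (forall z, Z z -> f z = 0) -> f = 0.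

(* Regular sections of O_Z(1): functions on the punctured cone which, locally
   in the Zariski topology, are quotients of homogeneous polynomials whose
   degrees differ by one.  Only the values of s on Z matter. *)
Definition section_O1 (Z : set U) (s : U -> K) : Prop :=
  forall z, Z z -> exists (d : nat) (p q : {mpoly K[n]}),
    [/\ p \is d.+1.-homog, q \is d.-homog, peval q z != 0 &
        forall u, Z u -> peval q u != 0 -> s u = peval p u / peval q u].

(* The restriction map from the dual of U to H^0(Z, O_Z(1)) is bijective *)
Definition linearly_normal (Z : set U) : Prop :=
  forall s, section_O1 Z s ->
    exists! f : 'Hom(U, K^o), forall u, Z u -> s u = f u.

(* Algebraic homomorphism from the multiplicative group to GL(U): rho is
   multiplicative and given by Laurent polynomials in t; its value at t = 0 is
   irrelevant.  *)
Definition multiplicative_subgroup (rho : K -> 'End(U)) : Prop :=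
  [/\ rho 1 = \1%VF,
      forall s t, s != 0 -> t != 0 -> rho (s * t) = (rho s \o rho t)%VF &
      exists (N m : nat) (A : 'I_m -> 'End(U)),
        forall t, t != 0 -> t ^+ N *: rho t = \sum_(k < m) t ^+ k *: A k].

(* As T_xZ = Hom(x, affine tangent space / x), the isotropy action of t on T_xZ
   is multiplication by t when rho t acts on the line x by chi and on the
   quotient of the affine tangent space by x as multiplication by t * chi. *)
Definition Euler_action_at (Z : set U) (x : U) (rho : K -> 'End(U)) : Prop :=
  forall t, t != 0 ->
    (forall z, Z z -> Z (rho t z)) /\
    exists chi : K, rho t x = chi *: x /\
      forall v, affine_tangent Z x v ->
        exists c : K, rho t v = (t * chi) *: v + c *: x.

Definition Euler_symmetric (Z : set U) : Prop :=
  exists W : set U, [/\ proj_closed W, ~ Z `<=` W &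
    forall x, Z x -> ~ W x ->
      exists2 rho, multiplicative_subgroup rho & Euler_action_at Z x rho].

(* The Lie algebra of infinitesimal linear automorphisms of the cone *)
Definition aut_cone (Z : set U) : set 'End(U) :=
  [set A : 'End(U) | forall z, Z z -> affine_tangent Z z (A z)].

Definition Hom_aut (Z : set U) : set 'Hom(U, 'End(U)) :=
  [set h : 'Hom(U, 'End(U)) | forall u, aut_cone Z (h u)].

(* Hom(wedge^2 U, W) is the space of alternating bilinear maps U x U -> W,
   in curried form. *)
Definition alternating (W : vectType K) : set 'Hom(U, 'Hom(U, W)) :=
  [set w : 'Hom(U, 'Hom(U, W)) | forall u, w u u = 0].

Definition partial (h : 'Hom(U, 'End(U))) : 'Hom(U, 'End(U)) :=
  linfun (fun u1 => linfun (fun u2 => h u1 u2 - h u2 u1) : 'End(U)).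

Definition wedge2 (Z : set U) : set 'Hom(U, 'Hom(U, K^o)) :=
  [set w : 'Hom(U, 'Hom(U, K^o)) | alternating w /\
           forall z v, Z z -> affine_tangent Z z v -> w z v = 0].

Definition tangentially_nondegenerate (Z : set U) : Prop :=
  wedge2 Z = [set 0].

Definition Xi0 (Z : set U) : set 'Hom(U, 'End(U)) :=
  [set sigma : 'Hom(U, 'End(U)) | alternating sigma /\
               forall z v, Z z -> affine_tangent Z z v -> sigma z v = 0].

Definition partial_inv_Xi0 (Z : set U) : set 'Hom(U, 'End(U)) :=
  [set h : 'Hom(U, 'End(U)) | Hom_aut Z h /\ Xi0 Z (partial h)].

Definition Utilde (Z : set U) : set 'Hom(U, 'End(U)) :=
  [set h : 'Hom(U, 'End(U)) | Hom_aut Z h /\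
           forall u, Z u -> h u u = 0 /\
             forall v, affine_tangent Z u v -> exists c : K, h u v = c *: u].

Definition first_prolongation (Z : set U) : set 'Hom(U, 'End(U)) :=
  [set h : 'Hom(U, 'End(U)) | Hom_aut Z h /\ forall u v, h u v = h v u].

(* theta h is the linear form with h u u = theta h u *: u on the cone; it exists
   and is unique when Z is non-degenerate and linearly normal and h lies in
   partial_inv_Xi0 Z. *)
Definition theta (Z : set U) (h : 'Hom(U, 'End(U))) : 'Hom(U, K^o) :=
  xget 0 [set f : 'Hom(U, K^o) | forall u, Z u -> h u u = (f u : K) *: u].

Lemma partialE h u1 u2 : partial h u1 u2 = h u1 u2 - h u2 u1.
Proof.
pose g u : U -> U := fun v => h u v - h v u.
have glin u : linear (g u).
  move=> a x y; rewrite /g !linearP /= add_lfunE scale_lfunE.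
  by rewrite scalerBr opprD addrACA.
pose gL u : {linear U -> U} :=
  HB.pack (g u) (@GRing.isLinear.Build K U U *:%R (g u) (glin u)).
have gLE u v : linfun (g u) v = g u v by rewrite (lfunE (gL u)).
have Glin : linear (fun u => linfun (g u) : 'End(U)).
  move=> a x y; apply/lfunP => v.
  rewrite add_lfunE scale_lfunE !gLE /g !linearP /= add_lfunE scale_lfunE.
  by rewrite scalerBr scalerN addrACA.
pose GL : {linear U -> 'End(U)} :=
  HB.pack (fun u => linfun (g u) : 'End(U))
    (@GRing.isLinear.Build K U 'End(U) *:%R _ Glin).
have -> : partial h u1 = linfun (g u1) by exact: (lfunE GL).
exact: gLE.
Qed.

End ProjectiveVarieties.

Arguments projective_space {K n}.
Arguments partial {K n} h.

(* Main.v *)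
(* The smoothness of Z enters only through the constancy of dim T_z: it provides
   polynomial vector fields tangent to Z through every tangent vector, hence a
   second fundamental form II_z with values in U / T_z.

   For h in the preimage of Xi0, the field q z = h z z satisfies q z in T_z and
   dq_z T_z in T_z.  This forces the line through z and q z to lie in Z with
   constant tangent space, along which II is a section of O(-1); so II_z = 0
   unless q z is proportional to z.  As II = 0 everywhere makes Z linear, theta
   exists by linear normality, and Utilde is its kernel.

   If theta h does not vanish at x, then h x acts on T_x by theta / 2 modulo x.
   The eigenvalues of B = h x - theta are integral multiples of - theta / 2, and
   the ideal of Z splits into weight spaces for B: this integrates the
   semisimple part of B to the Euler action.  If theta vanishes identically,
   then partial is injective because a symmetric h with h z z = 0 on Z is 0.
   The second part counts dimensions: when Utilde is 0, theta is injective, and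
   Xi0 is the tensor product of wedge2 and U. *)

Require Import Defs.
From HB Require Import structures.
From mathcomp Require Import all_boot all_order all_algebra.
From mathcomp Require Import mpoly ring zify.
From mathcomp Require Import boolp classical_sets functions reals complex.

Set Implicit Arguments.
Unset Strict Implicit.
Unset Printing Implicit Defensive.

Import GRing.Theory Num.Theory.

Local Open Scope ring_scope.
Local Open Scope classical_set_scope.

(** * Differential calculus of polynomials *)

Section PolynomialCalculus.
Variables (K : numClosedFieldType) (n : nat).
Local Notation U := 'rV[K]_n.
Implicit Types (f g p q : {mpoly K[n]}) (u v w x y z : U).

(** The lemmas hold over any [numClosedFieldType], so flows, limits and line bundles on P^1 all
    become identities between univariate polynomials: a limit is the value at 0 of a polynomial
    known off 0. Only straight lines are followed: those along a field all of whose derivatives of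
    an equation vanish on Z, and the orbits of a square-zero automorphism, where exp(sA) = 1 + sA. A
    value of II is likewise any vector xi that satisfies one linear relation with every equation of
    Z; it is determined modulo T_z. The factor 1/2 comes from polarization: h z z = theta(z) z
    differentiates to 2 h z v = theta(v) z + theta(z) v. The other eigenvalues of B on U are a
    priori unrelated to it. What relates them is that an eigenvalue that is not a multiple would
    come with equations of that weight, and these would confine Z to a proper subspace. *)

Lemma mpoly_algebra_ind (P : {mpoly K[n]} -> Prop) :
  (forall c, P c%:MP) -> (forall i p, P p -> P ('X_i * p)) ->
  (forall p q, P p -> P q -> P (p + q)) -> forall p, P p.
Proof.
move=> PC PX PD; elim/mpolyind => [|c m p _ _ Pp]; first by rewrite -mpolyC0.
apply: PD Pp; rewrite -mul_mpolyC mpolyXE_id.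
rewrite -big_enum /=; elim: (enum _) => [|i s IHs].
  by rewrite big_nil mulr1.
rewrite big_cons mulrCA; elim: (m i) => [|k IHk]; first by rewrite mul1r.
by rewrite exprS -mulrA; apply: PX.
Qed.

Lemma pevalC c z : peval (c%:MP : {mpoly K[n]}) z = c.
Proof. exact: mevalC. Qed.
Lemma pevalX i z : peval ('X_i : {mpoly K[n]}) z = z 0 i.
Proof. exact: mevalXU. Qed.
Lemma pevalD p q z : peval (p + q) z = peval p z + peval q z.
Proof. exact: mevalD. Qed.
Lemma pevalN p z : peval (- p) z = - peval p z.
Proof. exact: mevalN. Qed.
Lemma pevalB p q z : peval (p - q) z = peval p z - peval q z.
Proof. exact: mevalB. Qed.
Lemma pevalM p q z : peval (p * q) z = peval p z * peval q z.
Proof. exact: mevalM. Qed.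
Lemma pevalZ c p z : peval (c *: p) z = c * peval p z.
Proof. exact: mevalZ. Qed.
Lemma peval0 z : peval (0 : {mpoly K[n]}) z = 0.
Proof. exact: meval0. Qed.
Lemma peval_sum (I : Type) (r : seq I) (P : pred I) (F : I -> {mpoly K[n]}) z :
  peval (\sum_(i <- r | P i) F i) z = \sum_(i <- r | P i) peval (F i) z.
Proof. exact: raddf_sum. Qed.

Definition dird v f : {mpoly K[n]} := \sum_i v 0 i *: f^`M(i).

Lemma pdiffE f z v : pdiff f z v = peval (dird v f) z.
Proof.
rewrite /pdiff /dird peval_sum; apply: eq_bigr => i _.
by rewrite pevalZ mulrC.
Qed.

Lemma dird_is_linear v : linear (dird v).
Proof.
move=> c p q; rewrite /dird scaler_sumr -big_split /=.
by apply: eq_bigr => i _; rewrite mderivD mderivZ scalerDr !scalerA mulrC.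
Qed.

HB.instance Definition _ v :=
  GRing.isLinear.Build K {mpoly K[n]} {mpoly K[n]} _ (dird v) (dird_is_linear v).

Lemma dirdPl a v w f : dird (a *: v + w) f = a *: dird v f + dird w f.
Proof.
rewrite /dird scaler_sumr -big_split /=; apply: eq_bigr => i _.
by rewrite !mxE scalerDl scalerA.
Qed.

Lemma dird0l f : dird 0 f = 0.
Proof. by rewrite /dird big1 // => i _; rewrite mxE scale0r. Qed.

Lemma dirdZl a v f : dird (a *: v) f = a *: dird v f.
Proof. by rewrite -[a *: v]addr0 dirdPl dird0l addr0. Qed.

Lemma dirdDl v w f : dird (v + w) f = dird v f + dird w f.
Proof. by rewrite -[v]scale1r dirdPl !scale1r. Qed.

Lemma dirdNl v f : dird (- v) f = - dird v f.
Proof. by rewrite -scaleN1r dirdZl scaleN1r. Qed.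

Lemma dird_suml (I : Type) (r : seq I) (P : pred I) (F : I -> U) f :
  dird (\sum_(i <- r | P i) F i) f = \sum_(i <- r | P i) dird (F i) f.
Proof.
elim: r => [|i r IH]; first by rewrite !big_nil dird0l.
by rewrite !big_cons; case: (P i); rewrite // dirdDl IH.
Qed.

Lemma dirdE v f : dird v f = \sum_i v 0 i *: dird (delta_mx 0 i) f.
Proof.
rewrite {1}(row_sum_delta v) dird_suml.
by apply: eq_bigr => i _; rewrite dirdZl.
Qed.

Lemma dirdC v c : dird v (c%:MP : {mpoly K[n]}) = 0.
Proof. by rewrite /dird big1 // => i _; rewrite mderivC scaler0. Qed.

Lemma dirdX v i : dird v ('X_i : {mpoly K[n]}) = (v 0 i)%:MP.
Proof.
rewrite /dird (bigD1 i) //= mderivX mnmE eqxx scale1r.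
have -> : (U_(i) - U_(i))%MM = 0%MM :> 'X_{1..n}.
  by apply/mnmP => j; rewrite !mnmE subnn.
rewrite mpolyX0 -mul_mpolyC mulr1 big1 ?addr0 // => j ji.
by rewrite mderivX mnmE eq_sym (negPf ji) scale0r scaler0.
Qed.

Lemma dirdM v f g : dird v (f * g) = dird v f * g + f * dird v g.
Proof.
rewrite /dird mulr_suml mulr_sumr -big_split /=; apply: eq_bigr => i _.
by rewrite mderivM scalerDr scalerAl scalerAr.
Qed.

Lemma dird_comm v w f : dird v (dird w f) = dird w (dird v f).
Proof.
rewrite [dird w f]/dird linear_sum [RHS]/dird; apply: eq_bigr => i _ /=.
rewrite linearZ /=; congr (_ *: _).
rewrite /dird (@linear_sum K _ _ *:%R (mderiv i)); apply: eq_bigr => j _ /=.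
by rewrite linearZ /= mderiv_comm.
Qed.

(** The restriction of [f] to a line, kept as a polynomial in the parameter: a statement about
    generic parameters becomes an identity in [{poly K}]. *)
Definition line_poly f (a b : U) : {poly K} :=
  mmap polyC (fun i => (a 0 i)%:P + b 0 i *: 'X) f.

Lemma line_polyM f g a b :
  line_poly (f * g) a b = line_poly f a b * line_poly g a b.
Proof. exact: rmorphM. Qed.

Lemma line_polyD f g a b :
  line_poly (f + g) a b = line_poly f a b + line_poly g a b.
Proof. exact: mmapD. Qed.

Lemma line_polyC c a b : line_poly c%:MP a b = c%:P.
Proof. exact: mmapC. Qed.

Lemma line_polyX i a b : line_poly 'X_i a b = (a 0 i)%:P + b 0 i *: 'X.
Proof. by rewrite /line_poly mmapX mmap1U. Qed.

Lemma horner_line_poly f a b s : (line_poly f a b).[s] = peval f (a + s *: b).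
Proof.
elim/mpoly_algebra_ind: f => [c|i p IH|p q IHp IHq].
- by rewrite line_polyC pevalC hornerC.
- rewrite line_polyM pevalM hornerM IH line_polyX pevalX !mxE.
  by rewrite hornerD hornerC hornerZ hornerX [b 0 i * s]mulrC.
- by rewrite line_polyD pevalD hornerD IHp IHq.
Qed.

Lemma deriv_line_poly f a b : (line_poly f a b)^`() = line_poly (dird b f) a b.
Proof.
elim/mpoly_algebra_ind: f => [c|i p IH|p q IHp IHq].
- by rewrite line_polyC derivC dirdC -mpolyC0 line_polyC.
- rewrite line_polyM derivM IH line_polyX dirdM line_polyD !line_polyM dirdX.
  by rewrite line_polyC line_polyX derivD derivC derivZ derivX add0r alg_polyC.
- by rewrite line_polyD derivD IHp IHq linearD /= line_polyD.
Qed.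

Lemma derivn_line_poly k f a b :
  (line_poly f a b)^`(k) = line_poly (iter k (dird b) f) a b.
Proof. by elim: k => [//|k IH]; rewrite derivnS IH deriv_line_poly. Qed.

Lemma poly_eq0_derivn (p : {poly K}) : (forall k, p^`(k).[0] = 0) -> p = 0.
Proof.
move=> p0; apply/polyP => k; rewrite coef0.
have := p0 k; rewrite horner_coef0 coef_derivn addn0 ffactnn => /eqP.
by rewrite mulrn_eq0 -leqn0 leqNgt fact_gt0 /= => /eqP.
Qed.

Lemma poly_eq0_off0 (p : {poly K}) : (forall s, s != 0 -> p.[s] = 0) -> p = 0.
Proof.
move=> p0; apply/eqP; apply: contraT => pN0.
have := @max_poly_roots K p [seq (i.+1)%:R | i <- iota 0 (size p)] pN0.
rewrite size_map size_iota ltnn => -> //.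
  by apply/allP => _ /mapP[i _ ->]; apply/eqP/p0; rewrite pnatr_eq0.
rewrite map_inj_uniq ?iota_uniq // => i j /eqP.
by rewrite eqr_nat eqSS => /eqP.
Qed.

Lemma poly_eq0_all (p : {poly K}) : (forall s, p.[s] = 0) -> p = 0.
Proof. by move=> p0; apply: poly_eq0_off0. Qed.

(** Plays the part of a limit [s -> 0]: closed conditions pass from the punctured line to the point
    [a]. *)
Lemma peval_line_off0 f a b :
  (forall s, s != 0 -> peval f (a + s *: b) = 0) -> peval f a = 0.
Proof.
move=> f0; have l0 : line_poly f a b = 0.
  by apply: poly_eq0_off0 => s /f0; rewrite horner_line_poly.
by rewrite -[a]addr0 -(scale0r b) -horner_line_poly l0 horner0.
Qed.

Lemma peval_line_derivn f a b :
  (forall k, peval (iter k (dird b) f) a = 0) -> forall s, peval f (a + s *: b) = 0.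
Proof.
move=> f0 s; rewrite -horner_line_poly (@poly_eq0_derivn (line_poly f a b)).
  by rewrite horner0.
by move=> k; rewrite derivn_line_poly horner_line_poly scale0r addr0.
Qed.

Definition veval (X : 'I_n -> {mpoly K[n]}) x : U := \row_i peval (X i) x.

Definition vdiff (X : 'I_n -> {mpoly K[n]}) x v : U := \row_i pdiff (X i) x v.

Definition mcomp f (X : 'I_n -> {mpoly K[n]}) : {mpoly K[n]} :=
  f \mPo [tuple X i | i < n].

Lemma peval_mcomp f X x : peval (mcomp f X) x = peval f (veval X x).
Proof.
rewrite /peval /mcomp comp_mpoly_meval; apply: meval_eq => i.
by rewrite tnth_mktuple mxE.
Qed.

Lemma mcompD f g X : mcomp (f + g) X = mcomp f X + mcomp g X.
Proof. exact: comp_mpolyD. Qed.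

Lemma mcompM f g X : mcomp (f * g) X = mcomp f X * mcomp g X.
Proof. exact: rmorphM. Qed.

Lemma mcompC c X : mcomp c%:MP X = c%:MP.
Proof. exact: comp_mpolyC. Qed.

Lemma mcompXi i X : mcomp 'X_i X = X i.
Proof. by rewrite /mcomp comp_mpolyXU -tnth_nth tnth_mktuple. Qed.

Lemma pdiffM f g x v :
  pdiff (f * g) x v = pdiff f x v * peval g x + peval f x * pdiff g x v.
Proof. by rewrite !pdiffE dirdM pevalD !pevalM. Qed.

Lemma pdiffD f g x v : pdiff (f + g) x v = pdiff f x v + pdiff g x v.
Proof. by rewrite !pdiffE linearD /= pevalD. Qed.

Lemma pdiffX i x v : pdiff 'X_i x v = v 0 i.
Proof. by rewrite pdiffE dirdX pevalC. Qed.

Lemma pdiffC c x v : pdiff c%:MP x v = 0.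
Proof. by rewrite pdiffE dirdC peval0. Qed.

Lemma pdiffZ c f x v : pdiff (c *: f) x v = c * pdiff f x v.
Proof. by rewrite !pdiffE linearZ /= pevalZ. Qed.

Lemma pdiff_sum (I : Type) (r : seq I) (P : pred I) (F : I -> {mpoly K[n]}) z v :
  pdiff (\sum_(i <- r | P i) F i) z v = \sum_(i <- r | P i) pdiff (F i) z v.
Proof.
by rewrite pdiffE linear_sum peval_sum; apply: eq_bigr => i _; rewrite pdiffE.
Qed.

Lemma pdiffDr f x v w : pdiff f x (v + w) = pdiff f x v + pdiff f x w.
Proof. by rewrite !pdiffE dirdDl pevalD. Qed.

Lemma pdiffZr c f x v : pdiff f x (c *: v) = c * pdiff f x v.
Proof. by rewrite !pdiffE dirdZl pevalZ. Qed.

Lemma pdiffNr f x v : pdiff f x (- v) = - pdiff f x v.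
Proof. by rewrite !pdiffE dirdNl pevalN. Qed.

Lemma pdiff0r f x : pdiff f x 0 = 0.
Proof. by rewrite !pdiffE dird0l peval0. Qed.

Lemma pdiff_mcomp f X x v : pdiff (mcomp f X) x v = pdiff f (veval X x) (vdiff X x v).
Proof.
elim/mpoly_algebra_ind: f => [c|i p IH|p q IHp IHq].
- by rewrite mcompC !pdiffC.
- by rewrite mcompM !pdiffM IH mcompXi pdiffX !peval_mcomp pevalX !mxE.
- by rewrite mcompD !pdiffD IHp IHq.
Qed.

End PolynomialCalculus.

(** * The ideal and the tangent spaces of the cone *)

Section ConeIdeal.
Variables (K : numClosedFieldType) (n : nat) (Z : set 'rV[K]_n).
Hypothesis Zvar : proj_variety Z.
Local Notation U := 'rV[K]_n.
Implicit Types (f g p q : {mpoly K[n]}) (u v w x y z : U).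

Definition cone_ideal p : Prop := forall u, Z u -> peval p u = 0.

Lemma peval_homog d p c u : p \is d.-homog ->
  peval p (c *: u) = c ^+ d * peval p u.
Proof.
move=> /dhomogP hp; rewrite /peval !mevalE mulr_sumr.
rewrite big_seq [RHS]big_seq; apply: eq_bigr => m /hp dm.
rewrite mulrCA; congr (_ * _); rewrite -dm /= mdegE -prodrXr -big_split /=.
by apply: eq_bigr => i _; rewrite mxE exprMn.
Qed.

Lemma cone_neq0 u : Z u -> u != 0.
Proof. by case: Zvar => -[S [_ SP]] _ _ /SP[]. Qed.

Lemma cone_scale c u : c != 0 -> Z u -> Z (c *: u).
Proof.
case: Zvar => -[S [Shom SP]] _ _ c0 /SP[u0 Su]; apply/SP.
split=> [|p Sp]; first by rewrite scaler_eq0 negb_or c0.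
by have [d hd] := Shom p Sp; rewrite (peval_homog _ _ hd) Su ?mulr0.
Qed.

Lemma cone_nonempty : exists z, Z z.
Proof. by case: Zvar => _ [z Zz] _; exists z. Qed.

(** The vertex is a limit of points of [Z], which is nonempty and stable under scaling. *)
Lemma cone_idealP p :
  cone_ideal p <-> forall u, affine_cone Z u -> peval p u = 0.
Proof.
split=> [Ip u [->|]|Ip u Zu]; [|exact: Ip|by apply: Ip; right].
have [z Zz] := cone_nonempty; apply: (@peval_line_off0 _ _ _ _ z) => s s0.
by rewrite add0r; apply/Ip/cone_scale.
Qed.

Lemma tangentP z v :
  affine_tangent Z z v <-> forall p, cone_ideal p -> pdiff p z v = 0.
Proof. by split=> Tv p => [/cone_idealP|/cone_idealP]; apply: Tv. Qed.

Lemma cone_closed y : y != 0 -> (forall p, cone_ideal p -> peval p y = 0) -> Z y.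
Proof.
case: Zvar => -[S [_ SP]] _ _ y0 Iy; apply/SP; split=> // p Sp.
by apply: Iy => u /SP[_]; apply.
Qed.

Lemma cone_ideal_linear c p q :
  cone_ideal p -> cone_ideal q -> cone_ideal (c *: p + q).
Proof. by move=> Ip Iq u Zu; rewrite pevalD pevalZ Ip ?Iq // mulr0 addr0. Qed.

Lemma cone_ideal0 : cone_ideal 0.
Proof. by move=> u _; rewrite peval0. Qed.

Lemma cone_idealZ c p : cone_ideal p -> cone_ideal (c *: p).
Proof. by move=> Ip u Zu; rewrite pevalZ Ip ?mulr0. Qed.

Lemma cone_ideal_sum (I : Type) (r : seq I) (P : pred I) (F : I -> {mpoly K[n]}) :
  (forall i, P i -> cone_ideal (F i)) -> cone_ideal (\sum_(i <- r | P i) F i).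
Proof.
by move=> IF u Zu; rewrite peval_sum big1 // => i Pi; apply: IF.
Qed.

(** Along the ray through [u] the components of [p] are the coefficients of a polynomial in the
    scaling factor that vanishes off 0. *)
Lemma cone_ideal_pihomog d p : cone_ideal p -> cone_ideal (pihomog mdeg d p).
Proof.
(* The bound also exceeds [d], so that the component of degree [d] is among the coefficients even
   when [d] is large. *)
move=> Ip u Zu; pose k := maxn (msize p) d.+1.
pose P := \poly_(e < k) peval (pihomog mdeg e p) u.
suff P0 : P = 0.
  have := coef_poly k (fun e => peval (pihomog mdeg e p) u) d.
  by rewrite -/P P0 coef0 leq_maxr => ->.
apply: poly_eq0_off0 => s s0; rewrite horner_poly.
apply: etrans (Ip _ (cone_scale s0 Zu)).
rewrite [in RHS](@pihomog_partitionE _ _ mdeg k p) ?leq_maxl // peval_sum.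
by apply: eq_bigr => e _; rewrite (peval_homog _ _ (pihomogP _ _ _)) mulrC.
Qed.

Lemma pihomogM d e p q : p \is d.-homog ->
  pihomog mdeg (d + e) (p * q) = p * pihomog mdeg e q.
Proof.
move=> hp; pose k := maxn (msize q) e.+1.
rewrite {1}(@pihomog_partitionE _ _ mdeg k q) ?leq_maxl // mulr_sumr linear_sum /=.
have ek : (e < k)%N by rewrite leq_maxr.
rewrite (bigD1 (Ordinal ek)) //= pihomog_dE; last first.
  by apply: dhomogM => //; exact: pihomogP.
rewrite big1 ?addr0 // => i ie.
apply: (@pihomog_ne0 _ _ mdeg (d + i)); last by apply: dhomogM => //; exact: pihomogP.
by rewrite eqn_add2l.
Qed.

(** Irreducibility concerns sets cut out by homogeneous polynomials; since [q] is arbitrary, each of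
    its components is tested against [p] separately. *)
Lemma cone_ideal_prime d p q : p \is d.-homog ->
  cone_ideal (p * q) -> cone_ideal p \/ cone_ideal q.
Proof.
move=> hp Ipq; have [Ip|NIp] := pselect (cone_ideal p); [by left|right].
rewrite (@pihomog_partitionE _ _ mdeg _ q (leqnn _)).
apply: cone_ideal_sum => e _.
have {}Ipq : cone_ideal (p * pihomog mdeg e q).
  by rewrite -(pihomogM e q hp); apply: cone_ideal_pihomog.
case: Zvar => _ _ Zirr.
pose V f : set U := [set u | u != 0 /\ peval f u = 0].
have Vcl f c : f \is c.-homog -> proj_closed (V f).
  move=> hf; exists [set f]; split=> [_ ->|u]; first by exists c.
  split=> [[u0 fu]|[u0 fu]]; first by split=> // _ ->.
  by split=> //; apply: fu.
have [|H|H] := Zirr _ _ (Vcl _ _ hp) (Vcl _ _ (pihomogP mdeg e q)).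
- move=> u Zu; have /eqP := Ipq u Zu; rewrite pevalM mulf_eq0.
  by case/orP => /eqP H; [left|right]; split=> //; apply: cone_neq0.
- by case: NIp => u /H[].
- by move=> u /H[].
Qed.

Lemma affine_tangent0 z : affine_tangent Z z 0.
Proof. by move=> p _; rewrite pdiff0r. Qed.

Lemma affine_tangentD z v w :
  affine_tangent Z z v -> affine_tangent Z z w -> affine_tangent Z z (v + w).
Proof. by move=> Tv Tw p Ip; rewrite pdiffDr Tv ?Tw ?addr0. Qed.

Lemma affine_tangentZ z c v :
  affine_tangent Z z v -> affine_tangent Z z (c *: v).
Proof. by move=> Tv p Ip; rewrite pdiffZr Tv ?mulr0. Qed.

Lemma affine_tangentN z v : affine_tangent Z z v -> affine_tangent Z z (- v).
Proof. by move=> Tv; rewrite -scaleN1r; apply: affine_tangentZ. Qed.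

Lemma affine_tangentB z v w :
  affine_tangent Z z v -> affine_tangent Z z w -> affine_tangent Z z (v - w).
Proof. by move=> Tv Tw; apply/affine_tangentD/affine_tangentN. Qed.

Lemma cone_ideal_comp_scale (c : K) p : c != 0 -> cone_ideal p ->
  cone_ideal (mcomp p (fun i => c *: 'X_i)).
Proof.
move=> c0 Ip u Zu; rewrite peval_mcomp.
have -> : veval (fun i => c *: 'X_i) u = c *: u.
  by apply/rowP => i; rewrite !mxE pevalZ pevalX.
exact/Ip/cone_scale.
Qed.

Lemma pdiff_comp_scale (c : K) p z v :
  pdiff (mcomp p (fun i => c *: 'X_i)) z v = c * pdiff p (c *: z) v.
Proof.
rewrite pdiff_mcomp.
have -> : veval (fun i => c *: 'X_i) z = c *: z.
  by apply/rowP => i; rewrite !mxE pevalZ pevalX.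
have -> : vdiff (fun i => c *: 'X_i) z v = c *: v.
  by apply/rowP => i; rewrite !mxE pdiffZ pdiffX.
by rewrite pdiffZr.
Qed.

Lemma affine_tangent_scale (c : K) z v : c != 0 ->
  affine_tangent Z (c *: z) v -> affine_tangent Z z v.
Proof.
move=> c0 /tangentP Tv; apply/tangentP => p Ip.
have := Tv _ (cone_ideal_comp_scale (invr_neq0 c0) Ip).
rewrite pdiff_comp_scale scalerA mulVf // scale1r => /eqP.
by rewrite mulf_eq0 invr_eq0 (negPf c0) => /eqP.
Qed.

Lemma affine_tangent_self z : Z z -> affine_tangent Z z z.
Proof.
move=> Zz; apply/tangentP => p Ip.
have l0 : line_poly p 0 z = 0.
  apply: poly_eq0_off0 => s s0; rewrite horner_line_poly add0r.
  exact/Ip/cone_scale.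
rewrite pdiffE -[X in peval _ X]scale1r -[X in peval _ X]add0r.
by rewrite -horner_line_poly -deriv_line_poly l0 derivC horner0.
Qed.

(** Leibniz rule for [x |-> df_x (X x)]: this polynomial is in the ideal, so its derivative along a
    tangent vector is 0. *)
Lemma vfield_zero_diff (X : 'I_n -> {mpoly K[n]}) z v f :
  Z z -> affine_tangent Z z v ->
  (forall x, Z x -> pdiff f x (veval X x) = 0) ->
  pdiff f z (vdiff X z v) + pdiff (dird v f) z (veval X z) = 0.
Proof.
move=> Zz /tangentP Tv fX.
pose g := \sum_i dird (delta_mx 0 i) f * X i.
have gE x : peval g x = pdiff f x (veval X x).
  rewrite peval_sum pdiffE dirdE peval_sum; apply: eq_bigr => i _.
  by rewrite pevalM pevalZ mxE mulrC.
have /Tv : cone_ideal g by move=> x Zx; rewrite gE fX.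
rewrite pdiff_sum => <-; rewrite addrC !pdiffE [dird (veval _ _) _]dirdE.
rewrite [dird (vdiff _ _ _) _]dirdE !peval_sum -big_split /=.
apply: eq_bigr => i _; rewrite !pevalZ pdiffM !mxE pdiffE dird_comm.
by rewrite !pdiffE mulrC [X in _ + X]mulrC.
Qed.

End ConeIdeal.

(** * Tangent fields and the second fundamental form *)

Section ConstantRank.
Variables (K : numClosedFieldType) (n : nat) (Z : set 'rV[K]_n).
Hypothesis Zvar : proj_variety Z.
Variable r : nat.
Hypothesis Tdim : forall z, Z z -> has_vdim (affine_tangent Z z) r.
Local Notation U := 'rV[K]_n.
Local Notation I := (cone_ideal Z).
Local Notation T := (affine_tangent Z).
Implicit Types (f g p q : {mpoly K[n]}) (u v w x y z : U).

Lemma affine_tangent_eq y z : Z y -> Z z -> (forall v, T z v -> T y v) ->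
  forall v, T y v -> T z v.
Proof.
move=> Zy Zz sTzy v.
have [S [SP dS]] := Tdim Zy; have [S' [S'P dS']] := Tdim Zz.
have SS' : S' = S.
  apply/eqP; rewrite eqEdim dS dS' leqnn andbT.
  by apply/subvP => w /S'P /sTzy /SP.
by move=> Tyv; apply/S'P; rewrite SS'; apply/SP.
Qed.

Definition grad f z : U := \row_i peval f^`M(i) z.

Lemma pdiff_grad f z v : pdiff f z v = (v *m (grad f z)^T) 0 0.
Proof. by rewrite !mxE; apply: eq_bigr => i _; rewrite !mxE mulrC. Qed.

(** Independent gradients number at most [n], so a family of maximal size exists; a gradient outside
    its span could be adjoined to it. *)
Lemma gradient_basis z : exists c (F : 'I_c -> {mpoly K[n]}),
  [/\ forall i, I (F i), row_free (\matrix_i grad (F i) z) &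
      forall f, I f -> (grad f z <= \matrix_i grad (F i) z)%MS].
Proof.
pose P c := `[< exists F : 'I_c -> {mpoly K[n]},
  (forall i, I (F i)) /\ row_free (\matrix_i grad (F i) z) >].
have exP : exists c, P c.
  exists 0%N; apply/asboolP; exists (fun=> 0); split; first by case.
  by rewrite -row_leq_rank.
have ubP c : P c -> (c <= n)%N.
  by move=> /asboolP[F [_ /eqP rF]]; rewrite -[X in (X <= _)%N]rF rank_leq_col.
have [c /asboolP[F [IF freeF]] cmax] := ex_maxnP exP ubP.
exists c, F; split=> // f If; apply: contraT => NfF.
suff /cmax : P (1 + c)%N by rewrite ltnn.
apply/asboolP.
exists (fun i : 'I_(1 + c) => match fintype.split i with inl _ => f | inr j => F j end).
split=> [i|]; first by case: (fintype.split i).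
have -> : \matrix_(i < 1 + c)
    grad (match fintype.split i with inl _ => f | inr j => F j end) z =
    col_mx (grad f z) (\matrix_i grad (F i) z).
  apply/row_matrixP => i; rewrite rowK; case: fintype.splitP => j ij.
    have -> : i = lshift c j by apply: val_inj.
    by rewrite rowKu row_id // ord1.
  have -> : i = rshift 1 j by apply: val_inj.
  by rewrite rowKd rowK.
apply: inj_row_free => w; rewrite -[w]hsubmxK mul_row_col.
set a := lsubmx w; set b := rsubmx w => /eqP; rewrite addr_eq0 => /eqP ab.
have a0 : a = 0.
  apply/rowP => i; rewrite ord1; apply/eqP; apply: contraNT NfF.
  rewrite [X in _ != X]mxE => a00.
  have -> : grad f z = (a 0 0)^-1 *: (a *m grad f z).
    by rewrite {2}[a]mx11_scalar mul_scalar_mx scalerA mulVf ?scale1r.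
  by rewrite ab; apply/scalemx_sub; rewrite -mulNmx submxMl.
have b0 : b = 0.
  apply: (row_free_inj freeF); rewrite mul0mx.
  by apply/eqP; rewrite -oppr_eq0 -ab a0 mul0mx.
by rewrite a0 b0 row_mx0.
Qed.

(* Near z0 the cone is cut out to first order by c = n - r equations F, because
   the rank of their Jacobian cannot drop; v is projected to the kernel of the
   Jacobian by Cramer's rule. *)
Lemma tangent_field z0 v : Z z0 -> T z0 v ->
  exists X : 'I_n -> {mpoly K[n]},
    (forall z, Z z -> T z (veval X z)) /\ veval X z0 = v.
Proof.
move=> Zz0 Tv; have [c [F [IF freeF maxF]]] := gradient_basis z0.
pose ev (x : U) := meval (fun i => x 0 i) : {mpoly K[n]} -> K.
pose M x := \matrix_i grad (F i) x : 'M[K]_(c, n).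
pose Q0 := (pinvmx (M z0))^T : 'M[K]_(c, n).
pose J := \matrix_(i < n, j < c) (F j)^`M(i).
have evJ x : map_mx (ev x) J = (M x)^T by apply/matrixP => i j; rewrite !mxE.
pose Q := map_mx (@mpolyC n K) Q0.
have evC m (A : 'M[K]_(m, n)) x : map_mx (ev x) (map_mx (@mpolyC n K) A) = A.
  by apply/matrixP => i j; rewrite !mxE /ev mevalC.
have evZ m1 m2 x a (A : 'M_(m1, m2)) :
  map_mx (ev x) (a *: A) = ev x a *: map_mx (ev x) A by exact: map_mxZ.
have evM m1 m2 m3 x (A : 'M_(m1, m2)) (B : 'M_(m2, m3)) :
  map_mx (ev x) (A *m B) = map_mx (ev x) A *m map_mx (ev x) B by exact: map_mxM.
have evB m1 m2 x (A B : 'M_(m1, m2)) :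
  map_mx (ev x) (A - B) = map_mx (ev x) A - map_mx (ev x) B by exact: map_mxB.
pose D := Q *m J; pose d := \det D.
have evD x : map_mx (ev x) D = Q0 *m (M x)^T by rewrite map_mxM evJ evC.
have evd x : ev x d = \det (Q0 *m (M x)^T) by rewrite -evD det_map_mx.
have dz0 : ev z0 d = 1.
  by rewrite evd -trmx_mul mulmxVp // trmx1 det1.
pose vp := map_mx (@mpolyC n K) v.
(* The projection [v - v J D^-1 Q] with its denominator cleared. The outer factor [d] makes the
   field vanish where [d] does, since the kernel of the Jacobian may exceed the tangent space
   there. *)
pose X := d *: (d *: vp - vp *m J *m \adj D *m Q).
have XJ : X *m J = 0.
  rewrite -scalemxAl mulmxBl -scalemxAl -(mulmxA _ Q) -/D -(mulmxA _ (\adj D)).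
  by rewrite mul_adj_mx mul_mx_scalar subrr scaler0.
have vX x : veval (X 0) x = map_mx (ev x) X by apply/rowP => i; rewrite !mxE.
pose phi x := linfun (mulmxr (M x)^T) : 'Hom(U, 'rV[K]_c).
have phiE x w : phi x w = w *m (M x)^T by rewrite lfunE.
have Tphi x w : Z x -> T x w -> phi x w = 0.
  move=> Zx /tangentP Tw; apply/rowP => j; rewrite phiE !mxE.
  rewrite -[RHS](Tw Zvar _ (IF j)); apply: eq_bigr => i _.
  by rewrite !mxE mulrC.
have phiT w : phi z0 w = 0 -> T z0 w.
  rewrite phiE => wM; apply/tangentP => // f If; rewrite pdiff_grad.
  have /submxP[B ->] := maxF f If.
  by rewrite trmx_mul mulmxA wM mul0mx mxE.
have dker x : ev x d != 0 -> \dim (lker (phi x)) = \dim (lker (phi z0)).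
  move=> dx0; have full y : ev y d != 0 -> limg (phi y) = fullv.
    move=> dy0; apply/vspaceP => w.
    rewrite memvf; apply/memv_imgP; exists (w *m invmx (Q0 *m (M y)^T) *m Q0).
      exact: memvf.
    by rewrite phiE -(mulmxA _ Q0) mulmxKV // unitmxE -evd unitfE.
  have := limg_ker_dim (phi x) fullv; have := limg_ker_dim (phi z0) fullv.
  rewrite !full // ?dz0 ?oner_eq0 // => <- /eqP.
  by rewrite eqn_add2r !capfv => /eqP.
exists (X 0); split=> [z Zz|]; last first.
  rewrite vX /X evZ evB evZ dz0 !scale1r evC 2!evM (evM _ _ _ _ vp) evC evJ.
  by rewrite -phiE Tphi // !mul0mx subr0.
have [dz|dz] := eqVneq (ev z d) 0.
  by rewrite vX /X evZ dz scale0r; apply: affine_tangent0.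
have [S [SP dS]] := Tdim Zz; have [S0 [S0P dS0]] := Tdim Zz0.
apply/SP; have -> : S = lker (phi z).
  apply/eqP; rewrite eqEdim; apply/andP; split.
    by apply/subvP => w /SP /(Tphi _ _ Zz) w0; rewrite memv_ker w0.
  rewrite dker // dS -dS0; apply/dimvS/subvP => w.
  by rewrite memv_ker => /eqP /phiT /S0P.
by rewrite memv_ker phiE vX -evJ -evM XJ map_mx0.
Qed.

(* xi represents the value at (v, w) of the second fundamental form at z, which
   lives in U / T_z: differentiating df_x (X x) = 0 along v, for a field X that
   is tangent to Z, gives this relation with w = X z and xi = dX_z v. *)
Definition second_form z v w xi : Prop :=
  forall f, I f -> pdiff f z xi + pdiff (dird v f) z w = 0.

Lemma second_form_field z v X : Z z -> T z v ->
  (forall x, Z x -> T x (veval X x)) ->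
  second_form z v (veval X z) (vdiff X z v).
Proof.
move=> Zz Tv TX f If; apply: (vfield_zero_diff Zvar) => // x Zx.
by have /tangentP := TX x Zx; apply.
Qed.

Lemma second_form_exists z v w : Z z -> T z v -> T z w ->
  exists xi, second_form z v w xi.
Proof.
move=> Zz Tv /(tangent_field Zz)[X [TX <-]].
by exists (vdiff X z v); apply: second_form_field.
Qed.

Lemma second_formC z v w xi : second_form z v w xi -> second_form z w v xi.
Proof.
by move=> h f If; rewrite -[RHS](h f If) !pdiffE dird_comm.
Qed.

Lemma second_form_uniq z v w xi xi' :
  second_form z v w xi -> second_form z v w xi' -> T z (xi - xi').
Proof.
move=> h h'; apply/tangentP => // f If; rewrite pdiffDr pdiffNr.
by apply/eqP; rewrite subr_eq0 -(inj_eq (addIr (pdiff (dird v f) z w))) h ?h'.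
Qed.

Lemma second_formZl z c v w xi :
  second_form z v w xi -> second_form z (c *: v) w (c *: xi).
Proof.
by move=> h f If; rewrite dirdZl pdiffZ pdiffZr -mulrDr h ?mulr0.
Qed.

End ConstantRank.

(** * Lines along tangent fields *)

Section VectorFields.
Variables (K : numClosedFieldType) (n : nat).
Local Notation U := 'rV[K]_n.
Implicit Types (f g p : {mpoly K[n]}) (u v w x y z : U).
Variable q : 'I_n -> {mpoly K[n]}.

Lemma vdiff_is_linear x : linear (vdiff q x).
Proof. by move=> c v w; apply/rowP => i; rewrite !mxE pdiffDr pdiffZr. Qed.

HB.instance Definition _ x :=
  GRing.isLinear.Build K U U _ (vdiff q x) (vdiff_is_linear x).

(* The polynomial x |-> d^k f_x (q x, ..., q x). *)
Fixpoint contract k f : {mpoly K[n]} :=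
  if k is k'.+1 then \sum_i q i * contract k' (dird (delta_mx 0 i) f) else f.

Lemma contract_is_linear k : linear (contract k).
Proof.
elim: k => [//|k IH] c f g /=; rewrite scaler_sumr -big_split /=.
by apply: eq_bigr => i _; rewrite linearP /= IH mulrDr scalerAr.
Qed.

HB.instance Definition _ k :=
  GRing.isLinear.Build K {mpoly K[n]} {mpoly K[n]} _ (contract k)
    (contract_is_linear k).

Lemma contract_dird k v f :
  contract k (dird v f) = \sum_i v 0 i *: contract k (dird (delta_mx 0 i) f).
Proof.
by rewrite dirdE linear_sum; apply: eq_bigr => i _; rewrite linearZ.
Qed.

Lemma peval_contractS k f x :
  peval (contract k.+1 f) x = peval (contract k (dird (veval q x) f)) x.
Proof.
rewrite contract_dird /= !peval_sum; apply: eq_bigr => i _.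
by rewrite pevalM pevalZ mxE.
Qed.

Lemma peval_contract k f x :
  peval (contract k f) x = peval (iter k (dird (veval q x)) f) x.
Proof. by elim: k f => [//|k IH] f; rewrite peval_contractS IH iterSr. Qed.

(** One term differentiates [d^k f]; by symmetry its [k] arguments contribute equally to the other.
    At [k = 0] the truncated [k.-1] is harmless, its coefficient being 0. *)
Lemma pdiff_contract k f x v :
  pdiff (contract k f) x v = peval (contract k (dird v f)) x
    + k%:R * peval (contract k.-1 (dird (vdiff q x v) f)) x.
Proof.
elim: k f => [|k IH] f; first by rewrite mul0r addr0 pdiffE.
rewrite /= pdiff_sum peval_sum contract_dird peval_sum mulr_sumr -big_split /=.
rewrite (eq_bigr (fun i =>
  peval (q i) x * peval (contract k (dird (delta_mx 0 i) (dird v f))) x +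
  (pdiff (q i) x v * peval (contract k (dird (delta_mx 0 i) f)) x +
   k%:R * (peval (q i) x *
     peval (contract k.-1 (dird (delta_mx 0 i) (dird (vdiff q x v) f))) x)))).
  rewrite big_split /= [RHS]big_split /=; congr (_ + _).
    by apply: eq_bigr => i _; rewrite pevalM.
  rewrite big_split /= -mulr_sumr.
  have -> : k%:R * \sum_i peval (q i) x *
     peval (contract k.-1 (dird (delta_mx 0 i) (dird (vdiff q x v) f))) x =
     k%:R * peval (contract k (dird (vdiff q x v) f)) x.
    case: k {IH} => [|k]; first by rewrite !mul0r.
    by rewrite /= peval_sum; congr (_ * _); apply: eq_bigr => i _; rewrite pevalM.
  rewrite contract_dird peval_sum !mulr_sumr -big_split /=.
  apply: eq_bigr => i _; rewrite pevalZ mxE.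
  by rewrite -[k.+1]addn1 natrD mulrDl mul1r addrC.
move=> i _; rewrite pdiffM IH (dird_comm v) (dird_comm (vdiff q x v)).
by rewrite mulrDr addrCA [k%:R * _ in RHS]mulrCA.
Qed.

Definition shift_field (s : K) (i : 'I_n) : {mpoly K[n]} := 'X_i + s *: q i.

Lemma veval_shift s x : veval (shift_field s) x = x + s *: veval q x.
Proof. by apply/rowP => i; rewrite !mxE pevalD pevalX pevalZ. Qed.

Lemma vdiff_shift s x v : vdiff (shift_field s) x v = v + s *: vdiff q x v.
Proof. by apply/rowP => i; rewrite !mxE pdiffD pdiffX pdiffZ. Qed.

End VectorFields.

(** Cayley-Hamilton for a split characteristic polynomial, with the factors [A - l] applied one at a
    time: the shape needed for an induction on the roots. *)
Lemma split_annihilator (K : numClosedFieldType) n (A : 'M[K]_n) :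
  exists r : seq K,
    forall v : 'rV[K]_n, foldl (fun w l => w *m A - l *: w) v r = 0.
Proof.
case: n A => [|n] A; first by exists [::] => v; rewrite thinmx0.
have [r Dr] := closed_field_poly_normal (char_poly A); exists r => v.
have -> : foldl (fun w l => w *m A - l *: w) v r =
    v *m horner_mx A (\prod_(l <- r) ('X - l%:P)).
  elim: r v {Dr} => [|l r IH] v /=; first by rewrite big_nil rmorph1 mulmx1.
  rewrite IH big_cons rmorphM /= rmorphB /= horner_mx_X horner_mx_C.
  by rewrite mulmxA mulmxBr mul_mx_scalar.
have := Cayley_Hamilton A; rewrite {1}Dr (monicP (char_poly_monic A)) scale1r => ->.
by rewrite mulmx0.
Qed.

(** * Transport along the lines of a tangent field *)

Section TangentLines.
Variables (K : numClosedFieldType) (n : nat) (Z : set 'rV[K]_n).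
Hypothesis Zvar : proj_variety Z.
Variable r : nat.
Hypothesis Tdim : forall z, Z z -> has_vdim (affine_tangent Z z) r.
Local Notation U := 'rV[K]_n.
Local Notation I := (cone_ideal Z).
Local Notation T := (affine_tangent Z).
Implicit Types (f g p : {mpoly K[n]}) (u v w x y z : U).
Variable q : 'I_n -> {mpoly K[n]}.
Hypothesis Tq : forall z, Z z -> T z (veval q z).
Hypothesis Tdq : forall z v, Z z -> T z v -> T z (vdiff q z v).

(** The two claims support each other: as [q z] is tangent, the second gives the first one degree
    higher; differentiating that along [v] leaves, besides the wanted term, one with [dq_z v], which
    is tangent by [Tdq]. *)
Lemma contract_cone_ideal k f : I f ->
  I (contract q k f) /\
  forall z v, Z z -> T z v -> peval (contract q k (dird v f)) z = 0.
Proof.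
move=> If; elim: k => [|k [Ik Tk]].
  by split=> //= z v Zz /tangentP; rewrite -pdiffE; apply.
have Ik1 : I (contract q k.+1 f).
  by move=> z Zz; rewrite peval_contractS Tk //; apply: Tq.
split=> // z v Zz Tv; have /tangentP/(_ _ Ik1) := Tv.
rewrite pdiff_contract /= (Tk _ _ Zz (Tdq Zz Tv)) mulr0 addr0.
exact.
Qed.

Lemma tangent_line_ideal f z s : I f -> Z z ->
  peval f (z + s *: veval q z) = 0.
Proof.
move=> If Zz; apply: peval_line_derivn => k; rewrite -peval_contract.
by have [+ _] := contract_cone_ideal k If; apply.
Qed.

Lemma tangent_line_diff f z s v : I f -> Z z -> T z v ->
  pdiff f (z + s *: veval q z) v = 0.
Proof.
move=> If Zz Tv; rewrite pdiffE; apply: peval_line_derivn => k.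
rewrite -peval_contract.
by have [_ +] := contract_cone_ideal k If; apply.
Qed.

(** For a tangent field [X], the differential of [f] at [x + s q x] kills [X x] for all [x] in [Z],
    because [T_x] is tangent there too. Differentiating this along [v] moves [v] with the base
    point, while [w] and, modulo [T_z], [xi] stay put. *)
Lemma second_form_line z s v w xi : Z z -> T z v -> T z w ->
  second_form Z z v w xi ->
  second_form Z (z + s *: veval q z) (v + s *: vdiff q z v) w xi.
Proof.
move=> Zz Tv Tw xiP f If.
have [X [TX Xz]] := tangent_field Zvar Tdim Zz Tw.
pose g := \sum_i mcomp (dird (delta_mx 0 i) f) (shift_field q s) * X i.
have gE x : peval g x = pdiff f (x + s *: veval q x) (veval X x).
  rewrite peval_sum pdiffE dirdE peval_sum; apply: eq_bigr => i _.
  by rewrite pevalM pevalZ mxE peval_mcomp veval_shift mulrC.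
have Ig : I g by move=> x Zx; rewrite gE tangent_line_diff //; apply: TX.
have /tangentP/(_ _ Ig) := Tv; rewrite pdiff_sum.
have -> : xi = vdiff X z v + (xi - vdiff X z v) by rewrite addrC subrK.
rewrite pdiffDr (tangent_line_diff _ If Zz (v := xi - _)); last first.
  apply: (second_form_uniq Zvar xiP); rewrite -Xz.
  exact: (second_form_field Zvar).
move=> H; rewrite addr0 -[RHS]H // addrC !pdiffE [dird w _]dirdE.
rewrite [dird (vdiff _ _ _) _]dirdE !peval_sum -big_split /=.
apply: eq_bigr => i _; rewrite !pevalZ pdiffM pdiff_mcomp peval_mcomp.
rewrite veval_shift vdiff_shift pdiffE dird_comm -Xz !mxE.
by rewrite [_ * peval (X i) z]mulrC [_ * pdiff (X i) z v]mulrC.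
Qed.

Lemma dird_mcomp_scale (c : K) v f :
  dird v (mcomp f (fun i => c *: 'X_i)) = c *: mcomp (dird v f) (fun i => c *: 'X_i).
Proof.
elim/mpoly_algebra_ind: f => [a|i p IH|p1 p2 IH1 IH2].
- by rewrite mcompC !dirdC -mpolyC0 mcompC mpolyC0 scaler0.
- rewrite mcompM mcompXi dirdM IH dirdM mcompD !mcompM linearZ /= !dirdX mcompC.
  by rewrite mcompXi scalerDr -!scalerAl -!scalerAr.
- by rewrite mcompD linearD /= IH1 IH2 linearD /= mcompD scalerDr.
Qed.

(* The second fundamental form is homogeneous of degree -1 in the base point,
   so along a line with constant tangent space it is a regular section of
   O(-1), hence zero. *)
Lemma second_form_vanish z v w : Z z ->
  (forall c, veval q z != c *: z) -> T z v -> T z w -> second_form Z z v w 0.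
Proof.
move=> Zz qz; set y := veval q z in qz *.
have yN0 : y != 0 by have := qz 0; rewrite scale0r.
have Zline s : Z (z + s *: y).
  apply: (cone_closed Zvar) => [|f If]; last exact: tangent_line_ideal.
  have [->|s0] := eqVneq s 0.
    by rewrite scale0r addr0; apply: (cone_neq0 Zvar).
  apply: contra (qz (- s^-1)) => /eqP /(canRL (addrK _)); rewrite sub0r => ->.
  by rewrite scaleNr scalerN opprK scalerA mulVf // scale1r.
(* The point of the line at infinity: an eigenvalue 0 of [dq_z] puts the zero of the section
   there. *)
have Zy : Z y.
  apply: (cone_closed Zvar) => // f If; apply: (@peval_line_off0 _ _ f y z) => s s0.
  have -> : y + s *: z = s *: (z + s^-1 *: y).
    by rewrite scalerDr scalerA divff // scale1r addrC.
  exact/If/(cone_scale Zvar).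
have Tline s x : T (z + s *: y) x -> T z x.
  apply: (affine_tangent_eq Tdim) => // x' Tx'.
  by apply/tangentP => // f If; apply: tangent_line_diff.
have Ty x : T y x -> T z x.
  apply: (affine_tangent_eq Tdim) => // x' Tx'.
  apply/tangentP => // f If; rewrite pdiffE.
  apply: (@peval_line_off0 _ _ _ y z) => s s0; rewrite -pdiffE.
  have -> : y + s *: z = s *: (z + s^-1 *: y).
    by rewrite scalerDr scalerA divff // scale1r addrC.
  have : T (s *: (z + s^-1 *: y)) x'; last by move/tangentP; apply.
  apply: (@affine_tangent_scale _ _ _ Zvar s^-1); rewrite ?invr_eq0 //.
  rewrite scalerA mulVf // scale1r; apply/tangentP => // g Ig.
  exact: tangent_line_diff.
(* Induction along a product of factors [dq_z - l] that kills [v']. The form of [dq_z v' - l v']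
   vanishes already, so a generalized eigenvector behaves as an eigenvector. *)
suff main rr v' : T z v' -> foldl (fun x l => vdiff q z x - l *: x) v' rr = 0 ->
    forall s f w', I f -> T z w' -> pdiff (dird v' f) (z + s *: y) w' = 0.
  move=> Tv Tw f If; rewrite pdiff0r add0r.
  have [rr rrP] := split_annihilator (lin1_mx (vdiff q z)).
  rewrite -[z]addr0 -(scale0r y); apply: (main rr) => //.
  rewrite -[RHS](rrP v); elim: rr v {Tv rrP} => //= l rr IH v.
  by rewrite IH mul_rV_lin1.
elim: rr v' => [|l rr IH] v' Tv' /=.
  by move=> -> s f w' If Tw'; rewrite dird0l /pdiff big1 // => i _;
     rewrite mderiv0 peval0 mul0r.
have Tv1 : T z (vdiff q z v' - l *: v').
  by apply: affine_tangentB; [exact: Tdq|exact: affine_tangentZ].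
move=> /(IH _ Tv1){}IH s f w' If Tw'.
have [xi xiP] := second_form_exists Zvar Tdim Zz Tv' Tw'.
(* Modulo a vector of vanishing form, the transport of [v'] is [(1 + t * l) *: v']; this linear
   factor is the twist of O(-1). *)
have key t g : I g -> pdiff g (z + t *: y) xi +
    (1 + t * l) * pdiff (dird v' g) (z + t *: y) w' = 0.
  move=> Ig; rewrite -[RHS](second_form_line t Zz Tv' Tw' xiP Ig).
  congr (_ + _).
  have -> : v' + t *: vdiff q z v' =
      (1 + t * l) *: v' + t *: (vdiff q z v' - l *: v').
    by rewrite scalerBr scalerA scalerDl scale1r addrCA addrK addrC.
  by rewrite dirdDl pdiffD !dirdZl !pdiffZ IH // mulr0 addr0.
(* At the zero of [1 + t * l], that is at [t = - l^-1] or at [y] when [l = 0], the vector [xi] is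
   tangent; the tangent space is constant, so it is tangent at [z]. *)
have Txi : T z xi.
  have [l0|l0] := eqVneq l 0.
    apply: Ty; apply/tangentP => // g Ig; rewrite pdiffE.
    pose P := line_poly (dird xi g) y z + 'X * line_poly (dird w' (dird v' g)) y z.
    suff P0 : P = 0.
      have := horner0 (0 : K); rewrite -P0 hornerD hornerM hornerX mul0r addr0.
      by rewrite horner_line_poly scale0r addr0.
    apply: poly_eq0_off0 => t t0; rewrite hornerD hornerM hornerX.
    rewrite !horner_line_poly -!pdiffE; apply: (mulfI t0); rewrite mulr0.
    have /(key t^-1) := cone_ideal_comp_scale Zvar t0 Ig.
    rewrite l0 mulr0 addr0 mul1r dird_mcomp_scale pdiffZ !pdiff_comp_scale.
    rewrite -mulrDr.
    by rewrite scalerDr scalerA divff // scale1r [t *: z + y]addrC.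
  apply: (@Tline (- l^-1)); apply/tangentP => // g Ig.
  by have := key (- l^-1) g Ig; rewrite mulNr mulVf // subrr mul0r addr0.
have key2 t : (1 + t * l) * pdiff (dird v' f) (z + t *: y) w' = 0.
  by have := key t f If; rewrite tangent_line_diff // add0r.
rewrite pdiffE -horner_line_poly; set P := line_poly _ _ _.
suff -> : P = 0 by rewrite horner0.
have : (1 + l *: 'X) * P = 0.
  apply: poly_eq0_all => t; rewrite hornerM hornerD hornerZ hornerX hornerC.
  by rewrite horner_line_poly -pdiffE mulrC mulrC [l * t]mulrC key2.
move=> /eqP; rewrite mulf_eq0 => /orP[/eqP H|/eqP //].
have := congr1 (fun p : {poly K} => p.[0]) H.
rewrite hornerD hornerZ hornerX hornerC mulr0 addr0 horner0 => /eqP.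
by rewrite oner_eq0.
Qed.

End TangentLines.

(** * Subspaces containing the cone *)

(** Modulo the differences ['X_j - L j] each variable may be replaced by [L j]. It will be used with
    [L] a linear projection, to expand a polynomial that vanishes on its image. *)
Lemma divided_difference (K : numClosedFieldType) n (L : 'I_n -> {mpoly K[n]})
    (f : {mpoly K[n]}) :
  exists G : 'I_n -> {mpoly K[n]},
    f = mcomp f L + \sum_j G j * ('X_j - L j).
Proof.
elim/mpoly_algebra_ind: f => [c|i p [G pE]|p1 p2 [G1 p1E] [G2 p2E]].
- by exists (fun=> 0); rewrite mcompC big1 ?addr0 // => j _; rewrite mul0r.
- exists (fun j => (if j == i then p else 0) + L i * G j).
  rewrite mcompM mcompXi.
  under eq_bigr do rewrite mulrDl -mulrA.
  rewrite big_split /= -mulr_sumr (bigD1 i) //= eqxx big1 => [|j /negPf ->].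
    by rewrite addr0 addrCA -mulrDr -pE mulrBr [p * L i]mulrC subrK mulrC.
  by rewrite mul0r.
- exists (fun j => G1 j + G2 j); rewrite mcompD {1}p1E {1}p2E addrACA.
  by rewrite -big_split /=; under [in RHS]eq_bigr do rewrite mulrDl.
Qed.

Section LinearTrap.
Variables (K : numClosedFieldType) (n : nat) (Z : set 'rV[K]_n).
Hypothesis Zvar : proj_variety Z.
Local Notation U := 'rV[K]_n.
Local Notation I := (cone_ideal Z).
Implicit Types (f g p : {mpoly K[n]}) (u v w x y z : U).

Definition linear_field (A : 'M[K]_n) (i : 'I_n) : {mpoly K[n]} :=
  \sum_k A k i *: 'X_k.

Lemma veval_linear A x : veval (linear_field A) x = x *m A.
Proof.
apply/rowP => i; rewrite !mxE peval_sum; apply: eq_bigr => k _.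
by rewrite pevalZ pevalX mulrC.
Qed.

Lemma vdiff_linear A x v : vdiff (linear_field A) x v = v *m A.
Proof.
apply/rowP => i; rewrite !mxE pdiff_sum; apply: eq_bigr => k _.
by rewrite pdiffZ pdiffX mulrC.
Qed.

Lemma dhomog_coord (i : 'I_n) : ('X_i : {mpoly K[n]}) \is 1.-homog.
Proof. by rewrite dhomogX /= mdeg1. Qed.

Lemma dhomog_linear A i : linear_field A i \is 1.-homog.
Proof. by apply: rpred_sum => k _; apply/rpredZ/dhomog_coord. Qed.

(* If every linear form vanishing on the image of P is the differential at u of
   an element of I vanishing on that image, then near u the equations F force
   Z into the image of P; irreducibility does the rest. *)
Lemma cone_in_subspace (P : 'M[K]_n) u (F : 'I_n -> {mpoly K[n]}) :
  P *m P = P -> Z u -> u *m P = u -> (forall i, I (F i)) ->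
  (forall i x, peval (F i) (x *m P) = 0) ->
  (forall i v, pdiff (F i) u v = (v - v *m P) 0 i) ->
  forall z, Z z -> z *m P = z.
Proof.
move=> PP Zu uP IF FP dF z Zz.
have /choice[G GE] i := divided_difference (linear_field P) (F i).
have LE j x : peval ('X_j - linear_field P j) x = (x - x *m P) 0 j.
  by rewrite pevalB pevalX -veval_linear !mxE.
have dLE j x v : pdiff ('X_j - linear_field P j) x v = (v - v *m P) 0 j.
  by rewrite -(vdiff_linear P x) !mxE !pdiffE linearB /= pevalB -!pdiffE pdiffX.
have FE i x : peval (F i) x = \sum_j peval (G i j) x * (x - x *m P) 0 j.
  rewrite {1}(GE i) pevalD peval_mcomp veval_linear FP add0r peval_sum.
  by apply: eq_bigr => j _; rewrite pevalM LE.
have dFE i v : (v - v *m P) 0 i = \sum_j peval (G i j) u * (v - v *m P) 0 j.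
  rewrite -dF {1}(GE i) pdiffD pdiff_mcomp veval_linear vdiff_linear uP.
  rewrite dF -mulmxA PP subrr mxE add0r pdiff_sum; apply: eq_bigr => j _.
  by rewrite pdiffM LE dLE uP subrr mxE mulr0 add0r.
pose ev (x : U) := meval (fun i => x 0 i) : {mpoly K[n]} -> K.
pose N := \matrix_(j, i) G i j.
pose C A := map_mx (@mpolyC n K) A : 'M_n.
(* For [x] in [Z], [D] kills [x - x *m P]: [N] sends it to the values of [F] at [x], and [P] kills
   it. At [u] the first summand is [1 - P], so the second one completes [D] to the identity. *)
pose D := C (1%:M - P) *m N + C P.
pose d := \det D.
have evD x : map_mx (ev x) D = (1%:M - P) *m map_mx (ev x) N + P.
  have evC A : map_mx (ev x) (C A) = A.
    by apply/matrixP => i j; rewrite !mxE /ev mevalC.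
  have -> : map_mx (ev x) D = map_mx (ev x) (C (1%:M - P) *m N) + map_mx (ev x) (C P).
    exact: map_mxD.
  have -> : map_mx (ev x) (C (1%:M - P) *m N)
      = map_mx (ev x) (C (1%:M - P)) *m map_mx (ev x) N by exact: map_mxM.
  by rewrite !evC.
have evd x : peval d x = \det (map_mx (ev x) D) by rewrite det_map_mx.
have Nrow x v i : (v *m map_mx (ev x) N) 0 i = \sum_j peval (G i j) x * v 0 j.
  by rewrite !mxE; apply: eq_bigr => j _; rewrite !mxE mulrC.
have du : peval d u = 1.
  rewrite evd evD (_ : _ + P = 1%:M) ?det1 //.
  rewrite (_ : _ *m _ = 1%:M - P) ?subrK //.
  apply/row_matrixP => k; rewrite row_mul; apply/rowP => i.
  have -> : row k (1%:M - P) = delta_mx 0 k - delta_mx 0 k *m P.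
    by rewrite !rowE mulmxBr mulmx1.
  by rewrite Nrow -dFE.
have zd x : Z x -> (peval d x) *: (x - x *m P) = 0.
  move=> Zx; rewrite evd -mul_mx_scalar -mul_mx_adj mulmxA evD.
  rewrite (_ : (x - x *m P) *m (_ + P) = 0) ?mul0mx //.
  have yP : (x - x *m P) *m P = 0 by rewrite mulmxBl -mulmxA PP subrr.
  rewrite mulmxDr yP addr0 mulmxA mulmxBr mulmx1 yP subr0.
  by apply/rowP => i; rewrite Nrow -FE IF // mxE.
have {}zd j : I ('X_j - linear_field P j).
  have [||//|] := @cone_ideal_prime _ _ _ Zvar 1 ('X_j - linear_field P j) d.
  - by apply: rpredB; [exact: dhomog_coord|exact: dhomog_linear].
  - move=> x Zx; rewrite pevalM LE mulrC.
    by have /rowP/(_ j) := zd x Zx; rewrite !mxE.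
  - by move=> /(_ u Zu); rewrite du => /eqP; rewrite oner_eq0.
apply/rowP => j; apply/eqP; rewrite eq_sym -subr_eq0; apply/eqP.
by have := zd j z Zz; rewrite LE !mxE.
Qed.

End LinearTrap.

Lemma linear_hom (K : fieldType) (V W : vectType K) (g : V -> W) :
  linear g -> exists f : 'Hom(V, W), forall x, f x = g x.
Proof.
move=> gl; pose gL : {linear V -> W} :=
  HB.pack g (@GRing.isLinear.Build K V W *:%R _ gl).
by exists (linfun gL) => x; rewrite (lfunE gL).
Qed.

Section LinearCone.
Variables (K : numClosedFieldType) (n : nat) (Z : set 'rV[K]_n).
Hypothesis Zvar : proj_variety Z.
Variable r : nat.
Hypothesis Tdim : forall z, Z z -> has_vdim (affine_tangent Z z) r.
Hypothesis Znondeg : nondegenerate_variety Z.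
Local Notation U := 'rV[K]_n.
Local Notation I := (cone_ideal Z).
Local Notation T := (affine_tangent Z).
Implicit Types (f g p : {mpoly K[n]}) (u v w x y z : U).

Lemma nondegenerate_mx m (A : 'M[K]_(n, m)) :
  (forall z, Z z -> z *m A = 0) -> A = 0.
Proof.
move=> ZA; apply/matrixP => i j; rewrite [RHS]mxE.
have [|phi phiE] := @linear_hom K U K^o (fun x => (x *m A) 0 j).
  by move=> c x y; rewrite mulmxDl -scalemxAl !mxE.
have /lfunP/(_ (delta_mx 0 i)) : phi = 0.
  by apply: Znondeg => z /ZA zA; rewrite phiE zA mxE.
by rewrite phiE zero_lfunE -rowE mxE.
Qed.

(** Double annihilator: [T_z] is the common kernel of the gradients of the ideal, so a covector zero
    on it is a combination of finitely many of them. *)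
Lemma tangent_annihilator z (a : U) :
  (forall v, T z v -> v *m a^T = 0) -> exists2 f, I f & grad f z = a.
Proof.
move=> Ta; have [c [F [IF _ maxF]]] := gradient_basis Z z.
set M := \matrix_i grad (F i) z in maxF.
have TM v : v *m M^T = 0 -> T z v.
  move=> vM; apply/tangentP => // f /maxF/submxP[B fB].
  by rewrite pdiff_grad fB trmx_mul mulmxA vM mul0mx mxE.
have /submxP[B aB] : (a <= M)%MS.
  rewrite submxE -trmx_eq0 trmx_mul; apply/eqP/row_matrixP => k.
  rewrite row_mul row0; apply/Ta/TM.
  by rewrite -row_mul -trmx_mul mulmx_coker trmx0 row0.
exists (\sum_i B 0 i *: F i).
  by apply: cone_ideal_sum => i _; apply: cone_idealZ.
apply/rowP => j; rewrite aB !mxE.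
rewrite (@linear_sum K _ _ *:%R (mderiv j)) peval_sum; apply: eq_bigr => i _ /=.
by rewrite !mxE linearZ /= pevalZ.
Qed.

(** When II is zero, every tangent field [X] has [dX_z] mapping [T_z] to itself, so the lines
    [z + s X z] satisfy the equations and [T_z] lies in the cone. The covectors annihilating [T_z]
    are differentials of equations that vanish on [T_z]; this traps [Z] in [T_z], and non-degeneracy
    makes [T_z] everything. *)
Lemma linear_cone :
  (forall z v w, Z z -> T z v -> T z w -> second_form Z z v w 0) ->
  Z = projective_space.
Proof.
move=> II0; have [z Zz] := cone_nonempty Zvar.
have Tz_ideal f x : I f -> T z x -> peval f x = 0.
  move=> If Tx; have Txz : T z (x - z).
    by apply: affine_tangentB => //; apply: affine_tangent_self.
  have [X [TX Xz]] := tangent_field Zvar Tdim Zz Txz.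
  rewrite -[x](subrK z) addrC -Xz -[veval X z]scale1r.
  apply: (tangent_line_ideal Zvar TX) => // y v Zy Tv.
  rewrite -[vdiff X y v]subr0.
  apply: (second_form_uniq Zvar (second_form_field Zvar Zy Tv TX)).
  by apply: II0 => //; apply: TX.
have [S [SP _]] := Tdim Zz.
pose P := lin1_mx (projv S).
have xP x : x *m P = projv S x by rewrite mul_rV_lin1.
have TP x : T z (x *m P) by apply/SP; rewrite xP; apply: memv_proj.
have PT x : T z x -> x *m P = x by move=> /SP Sx; rewrite xP projv_id.
have /choice[F FP] i : exists f, I f /\ forall v, pdiff f z v = (v - v *m P) 0 i.
  have [|f If fa] := @tangent_annihilator z (col i (1%:M - P))^T.
    by move=> v Tv; rewrite trmxK colE mulmxA mulmxBr mulmx1 PT // subrr mul0mx.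
  exists f; split=> // v; rewrite pdiff_grad fa trmxK colE mulmxA.
  by rewrite mulmxBr mulmx1 -colE mxE.
have P1 : 1%:M - P = 0.
  apply: nondegenerate_mx => x Zx; rewrite mulmxBr mulmx1.
  rewrite (@cone_in_subspace _ _ _ Zvar P z F) ?subrr //.
  - by apply/row_matrixP => i; rewrite row_mul PT // rowE; apply: TP.
  - exact/PT/affine_tangent_self.
  - by move=> i; have [] := FP i.
  - by move=> i y; apply: Tz_ideal (TP y); have [] := FP i.
  - by move=> i v; have [_] := FP i; apply.
apply/seteqP; split=> x /=; first exact: cone_neq0.
move=> x0; apply: (cone_closed Zvar) => // f If; apply: Tz_ideal => //.
have <- : x *m P = x by rewrite -[RHS]mulmx1 -(subrK P 1%:M) P1 add0r.
exact: TP.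
Qed.

(** Otherwise some 2 x 2 minor of [(q x, x)] is nonzero at a point of [Z]. Its product with the
    second derivative [G] of an equation, taken along two tangent fields, vanishes at every point of
    [Z]: the minor where [q] is proportional, [G] elsewhere. By primality [G] vanishes on all of
    [Z]. *)
Lemma tangent_field_proportional d (q : 'I_n -> {mpoly K[n]}) :
  (forall i, q i \is d.-homog) ->
  (forall z, Z z -> T z (veval q z)) ->
  (forall z v, Z z -> T z v -> T z (vdiff q z v)) ->
  Z <> projective_space ->
  forall z, Z z -> exists c, veval q z = c *: z.
Proof.
move=> qhom Tq Tdq ZPU z1 Zz1; apply: contrapT => qz1; apply: ZPU.
apply: linear_cone => z v w Zz Tv Tw f If.
have [X [TX Xz]] := tangent_field Zvar Tdim Zz Tv.
have [Y [TY Yz]] := tangent_field Zvar Tdim Zz Tw.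
pose G := \sum_i X i * \sum_j Y j * dird (delta_mx 0 j) (dird (delta_mx 0 i) f).
have GE x : peval G x = pdiff (dird (veval X x) f) x (veval Y x).
  rewrite peval_sum pdiffE dird_comm dirdE peval_sum; apply: eq_bigr => i _.
  rewrite pevalZ pevalM mxE dird_comm [dird (veval Y x) _]dirdE !peval_sum.
  by congr (_ * _); apply: eq_bigr => j _; rewrite pevalM pevalZ mxE.
suff : I G by move/(_ z Zz); rewrite GE Xz Yz pdiff0r add0r.
have [i [j ij]] : exists i j, peval (q i * 'X_j - q j * 'X_i) z1 != 0.
  apply: contrapT => qij; apply: qz1.
  have /rV0Pn[j z1j] := cone_neq0 Zvar Zz1.
  exists (peval (q j) z1 / z1 0 j); apply/rowP => i; rewrite !mxE.
  apply: (mulIf z1j); rewrite mulrAC divfK //; apply/eqP; rewrite -subr_eq0.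
  apply: contrapT => /negP H; apply: qij; exists i, j.
  by rewrite pevalB !pevalM !pevalX.
have [|||] := @cone_ideal_prime _ _ _ Zvar (d + 1) (q i * 'X_j - q j * 'X_i) G.
- by apply: rpredB; apply: dhomogM => //; apply: dhomog_coord.
- move=> x Zx; rewrite pevalM.
  have [[c qc]|qc] := pselect (exists c, veval q x = c *: x).
    have qk k : peval (q k) x = c * x 0 k by have /rowP/(_ k) := qc; rewrite !mxE.
    by rewrite pevalB !pevalM !pevalX !qk mulrAC subrr mul0r.
  have qc' c : veval q x != c *: x by apply/eqP => E; apply: qc; exists c.
  have := second_form_vanish Zvar Tdim Tq Tdq Zx qc' (TX x Zx) (TY x Zx) If.
  by rewrite pdiff0r add0r GE => ->; rewrite mulr0.
- by move=> /(_ _ Zz1) H; rewrite H eqxx in ij.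
- exact.
Qed.

End LinearCone.

(** * Infinitesimal automorphisms and the first prolongation *)

Section QuadraticMaps.
Variables (K : numClosedFieldType) (n : nat).
Local Notation U := 'rV[K]_n.
Implicit Types (u v w x y z : U).
Variable B : U -> U -> U.
Hypothesis Bl : forall y, linear (B^~ y).
Hypothesis Br : forall x, linear (B x).

(** The coordinates of [x |-> B x x]. As a bare function, [B] may also be a composite such as
    [h a (h b x)]. *)
Definition quad_field (i : 'I_n) : {mpoly K[n]} :=
  \sum_j \sum_k (B (delta_mx 0 j) (delta_mx 0 k)) 0 i *: ('X_j * 'X_k).

Lemma bilinear_expand x y :
  B x y = \sum_j \sum_k (x 0 j * y 0 k) *: B (delta_mx 0 j) (delta_mx 0 k).
Proof.
pose Bll y' : {linear U -> U} :=
  HB.pack (B^~ y') (@GRing.isLinear.Build K U U *:%R _ (Bl y')).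
pose Brr x' : {linear U -> U} :=
  HB.pack (B x') (@GRing.isLinear.Build K U U *:%R _ (Br x')).
rewrite -[B x y]/(Bll y x) {1}(row_sum_delta x) linear_sum; apply: eq_bigr => j _.
rewrite linearZ /= -[B _ y]/(Brr (delta_mx 0 j) y) {1}(row_sum_delta y).
rewrite linear_sum scaler_sumr; apply: eq_bigr => k _.
by rewrite linearZ scalerA.
Qed.

Lemma dhomog_quad i : quad_field i \is 2.-homog.
Proof.
apply: rpred_sum => j _; apply: rpred_sum => k _; apply: rpredZ.
by apply: (@dhomogM _ _ _ 1 _ 1); apply: dhomog_coord.
Qed.

Lemma veval_quad x : veval quad_field x = B x x.
Proof.
rewrite bilinear_expand; apply/rowP => i; rewrite mxE peval_sum summxE.
apply: eq_bigr => j _; rewrite peval_sum summxE; apply: eq_bigr => k _.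
by rewrite pevalZ pevalM !pevalX !mxE mulrC.
Qed.

Lemma pdiff_quad i x v : pdiff (quad_field i) x v = (B x v + B v x) 0 i.
Proof.
rewrite mxE (bilinear_expand x) (bilinear_expand v) !summxE -big_split /=.
rewrite pdiff_sum; apply: eq_bigr => j _; rewrite !summxE -big_split /=.
rewrite pdiff_sum; apply: eq_bigr => k _.
rewrite pdiffZ pdiffM !pdiffX !pevalX !mxE -mulrDl addrC mulrC; congr (_ * _).
Qed.

Lemma vdiff_quad x v : vdiff quad_field x v = B x v + B v x.
Proof. by apply/rowP => i; rewrite mxE pdiff_quad. Qed.

Lemma pdiff_dird_quad i x v w :
  pdiff (dird v (quad_field i)) x w = (B v w + B w v) 0 i.
Proof.
rewrite mxE (bilinear_expand v) (bilinear_expand w) !summxE -big_split /=.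
rewrite linear_sum pdiff_sum; apply: eq_bigr => j _ /=.
rewrite !summxE -big_split linear_sum pdiff_sum; apply: eq_bigr => k _ /=.
rewrite linearZ /= pdiffZ dirdM !dirdX pdiffD !pdiffM !pdiffX !pdiffC !pevalC !mxE.
by rewrite mul0r mulr0 add0r addr0 -mulrDl mulrC.
Qed.

Variable Z : set 'rV[K]_n.
Hypothesis BZ : forall z, Z z -> B z z = 0.

Lemma quad_field_ideal i : cone_ideal Z (quad_field i).
Proof.
by move=> z /BZ; rewrite -veval_quad => /rowP/(_ i); rewrite !mxE.
Qed.

Hypothesis Zvar : proj_variety Z.

Lemma quad_polar z v : affine_tangent Z z v -> B z v + B v z = 0.
Proof.
move=> /tangentP Tv; apply/rowP => i; rewrite -pdiff_quad mxE Tv //.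
exact: quad_field_ideal.
Qed.

(** The quadrics given by [B] are equations of [Z], so they obey the relation that defines [xi];
    their second derivative is the polarization of [B]. *)
Lemma quad_second_form z v w xi : second_form Z z v w xi ->
  B v w + B w v = - (B z xi + B xi z).
Proof.
move=> h; apply/rowP => i; have := h _ (quad_field_ideal i).
rewrite pdiff_quad pdiff_dird_quad => E; rewrite [RHS]mxE.
by apply/eqP; rewrite -addr_eq0 addrC E.
Qed.

End QuadraticMaps.

Section AutCone.
Variables (K : numClosedFieldType) (n : nat) (Z : set 'rV[K]_n).
Hypothesis Zvar : proj_variety Z.
Local Notation U := 'rV[K]_n.
Local Notation I := (cone_ideal Z).
Local Notation T := (affine_tangent Z).
Implicit Types (f g p : {mpoly K[n]}) (u v w x y z : U) (A : 'End(U)).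

(** The Lie derivative of functions along the linear field [A]. *)
Definition flow_derivation A f : {mpoly K[n]} :=
  \sum_i linear_field (lin1_mx A) i * dird (delta_mx 0 i) f.

Lemma flow_derivation_is_linear A : linear (flow_derivation A).
Proof.
move=> c f g; rewrite /flow_derivation scaler_sumr -big_split /=.
by apply: eq_bigr => i _; rewrite linearP mulrDr scalerAr.
Qed.

HB.instance Definition _ A :=
  GRing.isLinear.Build K {mpoly K[n]} {mpoly K[n]} _ (flow_derivation A)
    (flow_derivation_is_linear A).

Lemma veval_lfun A x : veval (linear_field (lin1_mx A)) x = A x.
Proof. by rewrite veval_linear mul_rV_lin1. Qed.

Lemma vdiff_lfun A x v : vdiff (linear_field (lin1_mx A)) x v = A v.
Proof. by rewrite vdiff_linear mul_rV_lin1. Qed.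

Lemma peval_flow_derivation A f x : peval (flow_derivation A f) x = pdiff f x (A x).
Proof.
rewrite peval_sum pdiffE dirdE peval_sum; apply: eq_bigr => i _.
by rewrite pevalM pevalZ -veval_lfun mxE.
Qed.

Lemma pdiff_flow_derivation A f x v :
  pdiff (flow_derivation A f) x v = pdiff f x (A v) + pdiff (dird v f) x (A x).
Proof.
rewrite pdiff_sum !pdiffE dirdE [dird (A x) _]dirdE !peval_sum -big_split /=.
apply: eq_bigr => i _; rewrite pdiffM !pevalZ -(veval_lfun A x) -(vdiff_lfun A x v).
by rewrite !mxE (dird_comm _ v) [pdiff (dird _ _) _ _]pdiffE.
Qed.

Lemma flow_derivationM A f g :
  flow_derivation A (f * g) = flow_derivation A f * g + f * flow_derivation A g.
Proof.
rewrite /flow_derivation mulr_suml mulr_sumr -big_split /=.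
by apply: eq_bigr => i _; rewrite dirdM mulrDr mulrA [in RHS]mulrCA.
Qed.

Lemma dird_flow_derivation A f v :
  dird v (flow_derivation A f) = flow_derivation A (dird v f) + dird (A v) f.
Proof.
rewrite linear_sum [dird (A v) f]dirdE -big_split /=; apply: eq_bigr => i _.
rewrite dirdM addrC (dird_comm v); congr (_ + _).
have -> : dird v (linear_field (lin1_mx A) i) = ((A v) 0 i)%:MP.
  rewrite linear_sum -(mul_rV_lin1 A) mxE raddf_sum; apply: eq_bigr => k _.
  by rewrite linearZ /= dirdX -mul_mpolyC -mpolyCM mulrC.
by rewrite mul_mpolyC.
Qed.

Lemma flow_derivation_ideal A f : aut_cone Z A -> I f -> I (flow_derivation A f).
Proof.
move=> autA If z Zz; rewrite peval_flow_derivation.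
by have /tangentP := autA z Zz; apply.
Qed.

Lemma aut_second_form A z v : aut_cone Z A -> Z z -> T z v ->
  second_form Z z v (A z) (A v).
Proof.
move=> autA Zz /tangentP Tv f If.
by rewrite -pdiff_flow_derivation Tv //; apply: flow_derivation_ideal.
Qed.

Lemma aut_fixed_tangent A z v : aut_cone Z A -> Z z -> A z = 0 -> T z v -> T z (A v).
Proof.
move=> autA Zz Az /(aut_second_form autA Zz); rewrite Az => h.
by apply/tangentP => // f /h; rewrite pdiff0r addr0.
Qed.

(** Equivariance of II under the stabilizer of [z]. It is the relation for [xi] applied to the Lie
    derivative of [f]: commuting [A] past two derivatives produces [A v] and [A w], and the
    remaining terms contain [A z = 0]. *)
Lemma aut_fixed_second_form A z v w xi xi1 xi2 : aut_cone Z A -> A z = 0 ->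
  second_form Z z v w xi -> second_form Z z (A v) w xi1 ->
  second_form Z z v (A w) xi2 -> T z (A xi - xi1 - xi2).
Proof.
move=> autA Az h h1 h2; apply/tangentP => // f If.
have := h _ (flow_derivation_ideal autA If).
rewrite pdiff_flow_derivation dird_flow_derivation pdiffD pdiff_flow_derivation.
rewrite Az !pdiff0r !addr0 => /eqP; rewrite addr_eq0 => /eqP.
rewrite !pdiffDr !pdiffNr => ->.
have /eqP := h1 f If; rewrite addr_eq0 => /eqP ->.
have /eqP := h2 f If; rewrite addr_eq0 => /eqP ->.
by rewrite !opprK opprD subrK addNr.
Qed.

(** As [A^2 = 0], the curve is the exponential flow, and the derivatives of an equation along it are
    its iterated Lie derivatives, which are again equations. *)
Lemma square_zero_flow A z s f : aut_cone Z A -> (forall x, A (A x) = 0) ->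
  Z z -> I f -> peval f (z + s *: A z) = 0.
Proof.
move=> autA AA Zz If; rewrite -horner_line_poly.
rewrite (@poly_eq0_derivn _ (line_poly f z (A z))) ?horner0 // => k.
have dL g : (line_poly g z (A z))^`() = line_poly (flow_derivation A g) z (A z).
  apply/eqP; rewrite -subr_eq0; apply/eqP/poly_eq0_all => t.
  rewrite deriv_line_poly hornerD hornerN !horner_line_poly -pdiffE.
  by rewrite peval_flow_derivation linearD linearZ /= AA scaler0 addr0 subrr.
have -> : (line_poly f z (A z))^`(k) = line_poly (iter k (flow_derivation A) f) z (A z).
  by elim: k => [//|k IH]; rewrite derivnS IH dL.
rewrite horner_line_poly scale0r addr0.
suff : I (iter k (flow_derivation A) f) by apply.
by elim: k => [//|k IH]; apply: flow_derivation_ideal.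
Qed.

Lemma square_zero_flow_tangent A z s f v : aut_cone Z A ->
  (forall x, A (A x) = 0) -> Z z -> T z v -> I f ->
  pdiff f (z + s *: A z) (v + s *: A v) = 0.
Proof.
move=> autA AA Zz Tv If; pose X := shift_field (linear_field (lin1_mx A)) s.
have IX : I (mcomp f X).
  move=> x Zx; rewrite peval_mcomp veval_shift veval_lfun.
  exact: square_zero_flow.
have /tangentP/(_ _ IX) := Tv.
by rewrite pdiff_mcomp veval_shift vdiff_shift veval_lfun vdiff_lfun; apply.
Qed.

Lemma ideal_zero_scale s x : s != 0 -> (forall f, I f -> peval f x = 0) ->
  forall f, I f -> peval f (s *: x) = 0.
Proof.
move=> s0 Ix f /(cone_ideal_comp_scale Zvar s0)/Ix.
rewrite peval_mcomp; congr (peval _ _ = _).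
by apply/rowP => i; rewrite !mxE pevalZ pevalX.
Qed.

Lemma ideal_diff_scale s x v : s != 0 -> (forall f, I f -> pdiff f x v = 0) ->
  forall f, I f -> pdiff f (s *: x) v = 0.
Proof.
move=> s0 Ix f /(cone_ideal_comp_scale Zvar s0)/Ix.
by rewrite pdiff_comp_scale => /eqP; rewrite mulf_eq0 (negPf s0) => /eqP.
Qed.

End AutCone.

(** * Symmetric prolongations vanishing on the diagonal of the cone *)

Section Prolongation.
Variables (K : numClosedFieldType) (n : nat) (Z : set 'rV[K]_n).
Hypothesis Zvar : proj_variety Z.
Variable r : nat.
Hypothesis Tdim : forall z, Z z -> has_vdim (affine_tangent Z z) r.
Hypothesis Znondeg : nondegenerate_variety Z.
Local Notation U := 'rV[K]_n.
Local Notation I := (cone_ideal Z).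
Local Notation T := (affine_tangent Z).
Implicit Types (f g p : {mpoly K[n]}) (u v w x y z : U).

Lemma hom_linear_l (h : 'Hom(U, 'End(U))) y : linear (fun x => h x y).
Proof. by move=> c x x'; rewrite linearP /= add_lfunE scale_lfunE. Qed.

Lemma hom_linear_r (h : 'Hom(U, 'End(U))) x : linear (h x).
Proof. exact: linearP. Qed.

Lemma lfun_comp_linear (A : 'End(U)) (B : U -> U) : linear B -> linear (fun x => A (B x)).
Proof. by move=> Bl c x y; rewrite Bl linearP. Qed.

(* With y = h u w one has y in Z and T_y = (T_w :&: N^-1 T_w) + N T_w for
   N = h u.  As u lies in T_y, u = e + N v; then H = h v satisfies H y = - y,
   while H^2 v = 0, and the equivariance of the second fundamental form at w
   under H forces u, hence y, to vanish. *)
Lemma prolongation_pair_zero (h : 'Hom(U, 'End(U))) u w :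
  Hom_aut Z h -> (forall x y, h x y = h y x) -> (forall z, Z z -> h z z = 0) ->
  Z u -> Z w -> h u w = 0.
Proof.
move=> autH hC h0 Zu Zw.
have n2 : (2%:R : K) != 0 by rewrite pnatr_eq0.
have kill z v : Z z -> T z v -> h z v = 0.
  move=> Zz /(quad_polar (hom_linear_l h) (hom_linear_r h) h0 Zvar).
  by rewrite (hC v) -mulr2n -scaler_nat => /eqP; rewrite scaler_eq0 (negPf n2) => /eqP.
have Th z x : Z z -> T z (h z x) by move=> Zz; rewrite hC; apply: autH.
have sq0 z x : Z z -> h z (h z x) = 0 by move=> Zz; apply/kill/Th.
(* Polarization again, now of [z |-> h z (h z x)], which vanishes on [Z]. *)
have anti z v x : Z z -> T z v -> h z (h v x) = - h v (h z x).
  move=> Zz Tv; apply/eqP; rewrite -addr_eq0; apply/eqP.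
  apply: (@quad_polar _ _ (fun a b => h a (h b x)) _ _ Z _ Zvar) Tv => [b|a|y Zy].
  - exact: hom_linear_l.
  - exact/lfun_comp_linear/hom_linear_l.
  - exact: sq0.
have stab z v w' : Z z -> T z v -> T z w' -> T z (h v w').
  by move=> Zz Tv; apply: aut_fixed_tangent; rewrite // hC kill.
(* [h v] kills [z], so II is equivariant under it and [h v xi0 - 2 xi1] is tangent. With
   [h v v = - h z xi0] and [h (h v v) v = - h z xi1], applying [h z] to it gives three times
   [h v (h v v)]. *)
have sq_tangent z v : Z z -> T z v -> h v (h v v) = 0.
  move=> Zz Tv; have Tq := stab z v v Zz Tv Tv.
  have quad := quad_second_form (hom_linear_l h) (hom_linear_r h) h0.
  have dbl (a b : U) : a + a = - (b + b) -> a = - b.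
    rewrite -!mulr2n -!scaler_nat -scalerN; exact: scalerI.
  have [xi0 xi0P] := second_form_exists Zvar Tdim Zz Tv Tv.
  have [xi1 xi1P] := second_form_exists Zvar Tdim Zz Tq Tv.
  have q0 : h v v = - h z xi0.
    by apply: dbl; rewrite (quad _ _ _ _ xi0P) [h xi0 z]hC.
  have q1 : h (h v v) v = - h z xi1.
    by apply: dbl; have := quad _ _ _ _ xi1P; rewrite [h v (h v v)]hC [h xi1 z]hC.
  have hvz : h v z = 0 by rewrite hC kill.
  have := aut_fixed_second_form Zvar (autH v) hvz xi0P xi1P (second_formC xi1P).
  move=> /(kill z _ Zz); rewrite !linearB /= (anti z v xi0) //.
  rewrite -[h z xi0]opprK -q0 linearN opprK -[h z xi1]opprK -q1 !opprK [h (h v v) v]hC => E.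
  have : (3%:R : K) *: h v (h v v) = 0.
    by rewrite scaler_nat !mulrSr mulr0n add0r.
  by move/eqP; rewrite scaler_eq0 pnatr_eq0 => /eqP.
have [//|yN0] := eqVneq (h u w) 0; exfalso.
pose N := h u; pose y := h u w.
have NN x : N (N x) = 0 by apply: sq0.
have BB x : h w (h w x) = 0 by apply: sq0.
have ywu : h w u = y by rewrite hC.
have cancel_scale s x : s != 0 -> y + s *: x = s *: (x + s^-1 *: y).
  by move=> s0; rewrite scalerDr scalerA divff // scale1r addrC.
(* [y] is the point at infinity of the line [w + s *: y], the orbit of [w] under the square-zero
   [N]. *)
have Zy : Z y.
  apply: (cone_closed Zvar) => // f If; apply: (@peval_line_off0 _ _ f y w) => s s0.
  rewrite cancel_scale //; apply: (ideal_zero_scale Zvar s0) If => g Ig.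
  exact: (square_zero_flow Zvar).
have limit_tangent x v : (forall s f, I f -> pdiff f (x + s *: y) v = 0) -> T y v.
  move=> Hx; apply/tangentP => // f If; rewrite pdiffE.
  apply: (@peval_line_off0 _ _ _ y x) => s s0; rewrite -pdiffE cancel_scale //.
  by apply: (ideal_diff_scale Zvar s0) If => g Ig; apply: Hx.
have Tyu : T y u.
  apply: (limit_tangent u) => s f If.
  have flow v : T u v -> pdiff f (u + s *: y) (v + s *: h w v) = 0.
    by move=> Tv; rewrite -ywu; apply: (square_zero_flow_tangent Zvar).
  have dy : pdiff f (u + s *: y) y = 0.
    have := flow y (Th u w Zu).
    by rewrite -{3}ywu BB scaler0 addr0.
  have := flow u (affine_tangent_self Zvar Zu).
  by rewrite ywu pdiffDr pdiffZr dy mulr0 addr0.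
have flowN s f v : I f -> T w v -> pdiff f (w + s *: y) (v + s *: N v) = 0.
  by move=> If Tv; apply: (square_zero_flow_tangent Zvar).
have TyE e : T w e -> T w (N e) -> T y e.
  move=> Te TNe; apply: (limit_tangent w) => s f If.
  have := flowN s f (e - s *: N e) If.
  have -> : N (e - s *: N e) = N e.
    by rewrite [LHS]linearB /= [X in _ - X]linearZ /= -/N NN scaler0 subr0.
  rewrite subrK; apply.
  exact/affine_tangentB/affine_tangentZ.
have TyN v : T w v -> T y (N v).
  move=> Tv; apply/tangentP => // f If; rewrite pdiffE.
  pose P := line_poly (dird (N v) f) y w + 'X * line_poly (dird v f) y w.
  suff P0 : P = 0.
    have := horner0 (0 : K); rewrite -P0 hornerD hornerM hornerX mul0r addr0.
    by rewrite horner_line_poly scale0r addr0.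
  apply: poly_eq0_off0 => t t0; rewrite hornerD hornerM hornerX.
  rewrite !horner_line_poly -!pdiffE -pdiffZr -pdiffDr [N v + _]addrC cancel_scale //.
  apply: (ideal_diff_scale Zvar t0) If => g Ig.
  have := flowN t^-1 g v Ig Tv.
  have -> : t *: v + N v = t *: (v + t^-1 *: N v).
    by rewrite scalerDr scalerA divff // scale1r.
  by rewrite pdiffZr => ->; rewrite mulr0.
have [e [v [Te Tv uE]]] : exists e v, [/\ T w e, T w v & u = e + N v].
  have [Sy [SyP dSy]] := Tdim Zy; have [Sw [SwP dSw]] := Tdim Zw.
  (* [N] has the same kernel on [E] as on [T_w], and [E] meets [N T_w] in [N E]; so [E + N T_w] has
     the dimension of [T_w] and fills [T_y]. *)
  pose E := (Sw :&: N @^-1: Sw)%VS.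
  have EP x : (x \in E) = (x \in Sw) && (N x \in Sw).
    by rewrite memv_cap memv_preim.
  have sub : (E + N @: Sw <= Sy)%VS.
    apply/subvP => _ /memv_addP[x + [_ /memv_imgP[x' Sx' ->] ->]].
    rewrite EP => /andP[/SwP Tx /SwP TNx]; apply/SyP/affine_tangentD.
      exact: TyE.
    exact/TyN/SwP.
  have kerE : (E :&: lker N = Sw :&: lker N)%VS.
    apply/vspaceP => x; rewrite memv_cap EP [in RHS]memv_cap memv_ker -andbA.
    by congr (_ && _); apply/andb_idl => /eqP ->; apply: mem0v.
  have capE : (E :&: N @: Sw = N @: E)%VS.
    apply/vspaceP => x; rewrite memv_cap; apply/andP/memv_imgP.
      move=> [+ /memv_imgP[x' Sx' xE]]; rewrite EP => /andP[Sx _].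
      by exists x' => //; rewrite EP Sx' -xE.
    move=> [x' + ->]; rewrite !EP NN mem0v => /andP[Sx' SNx'].
    by rewrite SNx'; split=> //; apply/memv_imgP; exists x'.
  have dimE : \dim (E + N @: Sw) = \dim Sy.
    have := limg_ker_dim N Sw; have := limg_ker_dim N E.
    have := dimv_sum_cap E (N @: Sw)%VS; rewrite kerE capE dSy dSw => H1 H2 H3.
    apply/eqP; rewrite -(eqn_add2r (\dim (N @: E))) H1 -H2 -H3.
    by rewrite addnAC.
  have : u \in (E + N @: Sw)%VS.
    have -> : (E + N @: Sw)%VS = Sy by apply/eqP; rewrite eqEdim sub dimE leqnn.
    exact/SyP.
  move=> /memv_addP[e + [_ /memv_imgP[v Sv ->] ->]].
  by rewrite EP => /andP[/SwP Te _]; exists e, v; split=> //; apply/SwP.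
pose H := h v; have autN : aut_cone Z N by apply: autH.
have Hw : H w = 0 by rewrite /H hC kill.
have Hu : H u = u - e by rewrite /H hC {2}uE addrC addKr.
have He : T w (H e) by apply: stab.
have Hy : H y = - y.
  rewrite -[in LHS]ywu -[LHS]opprK -anti // -/H Hu linearB /= ywu.
  by rewrite (kill w e) // subr0.
have HHv : H (H v) = 0 by apply: sq_tangent Tv.
have THv : T w (H v) by apply: stab.
(* Since [N w = y], the value of II_w at [x] and [y] is represented by [N x]; equivariance under [H]
   with [H y = - y] gives the last summand. *)
have equiv x : T w x -> T w (H (N x) - N (H x) + N x).
  move=> Tx; have s2 := aut_second_form Zvar autN Zw Tx.
  have s1 : second_form Z w (H x) (N w) (N (H x)).
    by apply: aut_second_form => //; apply: stab.
  have s3 : second_form Z w x (H (N w)) (- N x).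
    rewrite Hy -scaleN1r -[- N x]scaleN1r; apply: second_formC.
    exact/second_formZl/second_formC.
  by have := aut_fixed_second_form Zvar (autH v) Hw s2 s1 s3; rewrite opprK.
have Nv : N v = u - e by rewrite {1}uE addrC addKr.
(* Taken at [v], the relation puts [2 u - N (H v)] in [T_w]; taken at [H v], which [H] kills, it
   then puts [4 u] there. *)
have T1 : T w (2%:R *: u - N (H v)).
  have := equiv v Tv; rewrite Nv linearB /= Hu => T'.
  have -> : 2%:R *: u - N (H v) = (u - e - H e - N (H v) + (u - e)) + (e + e + H e).
    rewrite scaler_nat mulr2n; apply/eqP; rewrite -subr_eq0.
    rewrite !opprD !opprK !addrA; apply/eqP.
    move: (H e) (N (H v)) => a b.
    apply/rowP => i; rewrite !mxE; ring.
  apply: affine_tangentD => //; apply: affine_tangentD => //.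
  exact: affine_tangentD.
have THNv x : T w x -> T w (H x) by apply: stab.
have T2 : T w (4%:R *: u).
  have := equiv _ THv; rewrite HHv linear0 subr0.
  have -> : N (H v) = 2%:R *: u - (2%:R *: u - N (H v)) by rewrite subKr.
  move: (_ - N (H v)) T1 => t Tt; rewrite linearB linearZ /= Hu => T'.
  have -> : 4%:R *: u = (2%:R *: (u - e) - H t + (2%:R *: u - t))
      + (2%:R *: e + H t + t).
    move: (H t) => a; apply/rowP => i; rewrite !mxE; ring.
  by apply: affine_tangentD => //; repeat apply: affine_tangentD => //;
     [apply: affine_tangentZ|apply: stab].
have Tu : T w u.
  rewrite -[u](scalerK (a := 4%:R)) ?unitfE ?pnatr_eq0 //.
  exact: affine_tangentZ.
by move: yN0; rewrite hC kill // eqxx.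
Qed.

Lemma prolongation_zero (h : 'Hom(U, 'End(U))) :
  Hom_aut Z h -> (forall x y, h x y = h y x) -> (forall z, Z z -> h z z = 0) ->
  h = 0.
Proof.
move=> autH hC h0.
have hZ w x : Z w -> h w x = 0.
  move=> Zw; suff : lin1_mx (h w) = 0.
    by move=> hw0; rewrite -(mul_rV_lin1 (h w)) hw0 mulmx0.
  apply: (nondegenerate_mx Znondeg) => u Zu; rewrite mul_rV_lin1 /= hC.
  exact: prolongation_pair_zero.
apply/lfunP => x; rewrite zero_lfunE; apply/lfunP => y; rewrite zero_lfunE.
suff : lin1_mx (h x) = 0.
  by move=> hx0; rewrite -(mul_rV_lin1 (h x)) hx0 mulmx0.
apply: (nondegenerate_mx Znondeg) => w Zw; rewrite mul_rV_lin1 /= hC.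
exact: hZ.
Qed.

End Prolongation.

(** * Weights and Euler actions *)

Section SpectralIdempotents.
Variable K : numClosedFieldType.

Let prim (r : seq K) m : {poly K} := \prod_(l <- r) ('X - l%:P) ^+ m.

(** Chinese remainder theorem: modulo [prim r m] the [e l] are the orthogonal idempotents of the
    local factors. *)
Lemma poly_idempotents (r : seq K) m : uniq r ->
  exists e : K -> {poly K},
    [/\ prim r m %| 1 - \sum_(l <- r) e l,
        {in r, forall l, prim r m %| ('X - l%:P) ^+ m * e l} &
        {in r &, forall l l', l != l' -> prim r m %| e l * e l'}].
Proof.
elim: r => [_|l r IH /= /andP[lr ur]].
  by exists (fun=> 0); split=> [|//|//]; rewrite /prim big_nil dvd1p.
have [e [sum1 ann orth]] := IH ur.
have cop : coprimep (('X - l%:P) ^+ m) (prim r m).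
  apply: coprimep_expl; rewrite /prim big_seq; elim/big_rec: _ => [|l' p l'r IHp].
    exact: coprimep1.
  rewrite coprimepMr IHp andbT; apply: coprimep_expr.
  rewrite coprimep_XsubC root_XsubC; apply/eqP => E.
  have {}E : l = l' by []; by move: lr; rewrite E l'r.
have /Bezout_eq1_coprimepP[[a b] /= ab1] := cop.
set c := ('X - l%:P) ^+ m in cop ab1 *.
have primE : prim (l :: r) m = c * prim r m by rewrite /prim big_cons.
(* In [a * c + b * prim r m = 1] the second summand is the idempotent of the new root, and the first
   cuts down the old ones. *)
pose e' l' := if l' == l then b * prim r m else a * c * e l'.
have e'l : e' l = b * prim r m by rewrite /e' eqxx.
have e'r l' : l' \in r -> e' l' = a * c * e l'.
  by rewrite /e'; case: eqP => // ->; rewrite (negPf lr).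
exists e'; split.
- rewrite primE big_cons e'l (eq_big_seq _ e'r) -mulr_sumr -{1}ab1.
  move: (\sum_(l' <- r) e l') sum1 => S sum1.
  rewrite [X in _ %| X](_ : _ = a * (c * (1 - S))); last by ring.
  by apply: dvdp_mull; rewrite dvdp_mul2l ?expf_neq0 ?polyXsubC_eq0.
- move=> l'; rewrite inE primE => /orP[/eqP ->|l'r].
    by rewrite e'l mulrCA -/c; apply: dvdp_mull; exact: dvdpp.
  rewrite e'r // [X in _ %| X](_ : _ = c * (a * (('X - l'%:P) ^+ m * e l')));
    last by ring.
  by rewrite dvdp_mul2l ?expf_neq0 ?polyXsubC_eq0 //; apply/dvdp_mull/ann.
- move=> l1 l2; rewrite !inE primE => /orP[/eqP ->|l1r] /orP[/eqP ->|l2r].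
  + by rewrite eqxx.
  + move=> _; rewrite e'l e'r //.
    rewrite [X in _ %| X](_ : _ = b * a * e l2 * (c * prim r m)); last by ring.
    exact: dvdp_mull.
  + move=> _; rewrite e'l e'r //.
    rewrite [X in _ %| X](_ : _ = b * a * e l1 * (c * prim r m)); last by ring.
    exact: dvdp_mull.
  + move=> l12; rewrite !e'r //.
    rewrite [X in _ %| X](_ : _ = a ^+ 2 * c * (c * (e l1 * e l2))); last by ring.
    by apply: dvdp_mull; rewrite dvdp_mul2l ?expf_neq0 ?polyXsubC_eq0 //; apply: orth.
Qed.

(** Nilpotency is stated by iterating [M |-> A M - l M] because this is how a shifted Lie derivative
    acts on linear fields. *)
Lemma spectral_decomposition n (A : 'M[K]_n) :
  exists (r : seq K) (P : K -> 'M[K]_n) (m : nat),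
    [/\ uniq r, \sum_(l <- r) P l = 1%:M,
        {in r &, forall l l', P l *m P l' = if l == l' then P l else 0} &
        {in r, forall l, iter m (fun M => A *m M - l *: M) (P l) = 0}].
Proof.
case: n A => [|n] A.
  by exists [::], (fun=> 0), 0%N; split=> //; rewrite big_nil [RHS]flatmx0.
have [s Ds] := closed_field_poly_normal (char_poly A).
rewrite (monicP (char_poly_monic A)) scale1r in Ds.
(* [m] bounds all multiplicities, so the characteristic polynomial divides [prim r m]. *)
pose r := undup s; pose m := size s.
have [e [sum1 ann orth]] := poly_idempotents m (undup_uniq s).
have killp p : prim r m %| p -> horner_mx A p = 0.
  move=> /(dvdp_trans _) H; have {}H : char_poly A %| p.
    apply: H; rewrite Ds -(prodr_undup_exp_count s xpredT).
    rewrite -/r /prim; elim: r {sum1 ann orth} => [|l r' IH]; first by rewrite !big_nil.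
    by rewrite !big_cons; apply: dvdp_mul IH; apply/dvdp_exp2l/count_size.
  by rewrite -(divpK H) rmorphM /= Cayley_Hamilton mulr0.
have sumP : \sum_(l <- r) horner_mx A (e l) = 1%:M.
  apply/eqP; rewrite eq_sym -subr_eq0; apply/eqP.
  apply: etrans (killp _ sum1); rewrite [RHS]rmorphB rmorph_sum /=.
  by congr (_ - _); rewrite [RHS]rmorph1.
have orthP l l' : l \in r -> l' \in r -> l != l' ->
    horner_mx A (e l) *m horner_mx A (e l') = 0.
  move=> lr l'r ll'; rewrite -[LHS]/(horner_mx A (e l) * horner_mx A (e l')).
  by rewrite -rmorphM; apply/killp/orth.
exists r, (fun l => horner_mx A (e l)), m; split=> [|//|l l' lr l'r|l lr].
- exact: undup_uniq.
- have [<-|ll'] := eqVneq l l'; last exact: orthP.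
  rewrite -[RHS]mulmx1 -sumP (bigD1_seq l) ?undup_uniq //= mulmxDr.
  rewrite mulmx_sumr big_seq_cond big1 ?addr0 // => j /andP[jr jl].
  by rewrite orthP // eq_sym.
- rewrite -[RHS](killp _ (ann l lr)); elim: m {ann sum1 orth killp} => [|k IH].
    by rewrite mul1r.
  rewrite iterS IH exprS -mulrA [in RHS]rmorphM /= rmorphB /= horner_mx_X.
  by rewrite horner_mx_C mulrBl -mul_scalar_mx.
Qed.

End SpectralIdempotents.

(** * Generalized eigencomponents of a stable subspace *)

Section StableSubspaces.
Variables (K : numClosedFieldType) (V : lmodType K) (D : {linear V -> V}).
Implicit Types (f g : V).

Definition eigen_shift (k : K) f : V := D f - k *: f.

Lemma eigen_shift_is_linear k : linear (eigen_shift k).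
Proof.
move=> c f g; rewrite /eigen_shift linearP scalerDr opprD addrACA scalerBr.
by rewrite !scalerA mulrC.
Qed.

HB.instance Definition _ k :=
  GRing.isLinear.Build K V V _ (eigen_shift k) (eigen_shift_is_linear k).

Lemma iter_eigen_shift_is_linear m k : linear (iter m (eigen_shift k)).
Proof. by elim: m => [//|m IH] c f g; rewrite !iterS IH linearP. Qed.

HB.instance Definition _ m k :=
  GRing.isLinear.Build K V V _ (iter m (eigen_shift k))
    (iter_eigen_shift_is_linear m k).

Lemma eigen_shiftC k l f :
  eigen_shift k (eigen_shift l f) = eigen_shift l (eigen_shift k f).
Proof.
rewrite /eigen_shift !linearB !linearZ /= !scalerA [l * k]mulrC.
by rewrite addrACA.
Qed.

Lemma iter_eigen_shiftC m k l f :
  eigen_shift l (iter m (eigen_shift k) f) = iter m (eigen_shift k) (eigen_shift l f).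
Proof. by elim: m => [//|m IH]; rewrite !iterS eigen_shiftC IH. Qed.

Lemma iter_eigen_shiftC2 m m' k l f :
  iter m' (eigen_shift l) (iter m (eigen_shift k) f) =
  iter m (eigen_shift k) (iter m' (eigen_shift l) f).
Proof. by elim: m' => [//|m' IH]; rewrite !iterS IH iter_eigen_shiftC. Qed.

Variable I : V -> Prop.
Hypothesis I0 : I 0.
Hypothesis I_linear : forall c f g, I f -> I g -> I (c *: f + g).
Hypothesis ID : forall f, I f -> I (D f).

Lemma stableZ c f : I f -> I (c *: f).
Proof. by move=> If; rewrite -[_ *: _]addr0; apply: I_linear. Qed.

Lemma stableB f g : I f -> I g -> I (f - g).
Proof. by move=> If Ig; rewrite addrC -scaleN1r; apply: I_linear. Qed.

Lemma stable_shift k f : I f -> I (eigen_shift k f).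
Proof. by move=> If; apply: stableB; [apply: ID|apply: stableZ]. Qed.

(** The two shifts differ by the nonzero scalar [l - k], and applying either one lowers an
    exponent. *)
Lemma stable_coprime a b k l f : k != l ->
  I (iter a (eigen_shift k) f) -> I (iter b (eigen_shift l) f) -> I f.
Proof.
move=> kl; move: {2}(a + b)%N (leqnn (a + b)) => N.
elim: N a b f => [|N IH] [|a] [|b] f //= abN; rewrite -!iterS => Ia Ib.
have If1 : I (eigen_shift k f).
  apply: (IH a b.+1); first by rewrite -ltnS.
    by rewrite -iterSr.
  by rewrite -iter_eigen_shiftC; apply: stable_shift.
have If2 : I (eigen_shift l f).
  apply: (IH a.+1 b); first by rewrite addSnnS -ltnS.
    by rewrite -iter_eigen_shiftC; apply: stable_shift.
  by rewrite -iterSr.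
have := stableZ (l - k)^-1 (stableB If1 If2).
have -> : eigen_shift k f - eigen_shift l f = (l - k) *: f.
  by rewrite /eigen_shift opprB addrC addrA subrK scalerBl.
by rewrite scalerA mulVf ?scale1r // subr_eq0 eq_sym.
Qed.

(** A power of its shift kills [F k] and leaves a shorter sum; coprimality of the shifts then undoes
    that power on the other components. *)
Lemma stable_eigen_components (s : seq K) (F : K -> V) : uniq s ->
  (forall k, exists m, iter m (eigen_shift k) (F k) = 0) ->
  I (\sum_(k <- s) F k) -> {in s, forall k, I (F k)}.
Proof.
elim: s F => [//|k s IH] F /= /andP[ks us] nilF; rewrite big_cons => IFs.
have [m Fk0] := nilF k.
have IF : {in s, forall l, I (F l)}.
  move=> l ls; have [m' Fl0] := nilF l.
  have kl : k != l by apply: contraNneq ks => ->.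
  apply: (stable_coprime (a := m) (b := m') kl); last by rewrite Fl0.
  apply: (IH (fun l => iter m (eigen_shift k) (F l))) ls => // [j|].
    by have [j' Fj0] := nilF j; exists j'; rewrite iter_eigen_shiftC2 Fj0 linear0.
  have : I (iter m (eigen_shift k) (F k + \sum_(j <- s) F j)).
    by elim: (m) => [//|i IHi]; rewrite iterS; apply: stable_shift.
  by rewrite linearD /= Fk0 add0r linear_sum.
have Isum : I (\sum_(j <- s) F j).
  rewrite big_seq; elim/big_ind: _ => // f g If Ig.
  by rewrite -[f]scale1r; apply: I_linear.
move=> l; rewrite inE => /orP[/eqP ->|]; last exact: IF.
by rewrite -[F k](addrK (\sum_(j <- s) F j)); apply: stableB.
Qed.

End StableSubspaces.

(** * Weight spaces of the polynomial ring *)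

Section Weights.
Variables (K : numClosedFieldType) (n : nat).
Local Notation U := 'rV[K]_n.
Implicit Types (f g p : {mpoly K[n]}) (u v w x y z : U).
Variables (A : 'End(U)) (r : seq K) (P : K -> 'M[K]_n) (m : nat).
Hypothesis sumP : \sum_(l <- r) P l = 1%:M.
Hypothesis nilP :
  {in r, forall l, iter m (fun M => lin1_mx A *m M - l *: M) (P l) = 0}.

Local Notation shift := (eigen_shift (flow_derivation A)).

(** The generalized weight spaces of the Lie derivative, generated by the coordinates of [x *m P l],
    which have weight [l]. Explicit generators allow induction on the way a polynomial of given
    weight is built. *)
Inductive weighted : K -> {mpoly K[n]} -> Prop :=
| weighted0 k : weighted k 0
| weightedC c : weighted 0 c%:MP
| weightedX l i k p : l \in r -> weighted k p ->
    weighted (l + k) (linear_field (P l) i * p)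
| weightedD k p q : weighted k p -> weighted k q -> weighted k (p + q).

Lemma shiftM k l f g : shift (k + l) (f * g) = shift k f * g + f * shift l g.
Proof.
rewrite /eigen_shift /= flow_derivationM mulrBl mulrBr scalerDl opprD addrACA.
by rewrite scalerAl scalerAr.
Qed.

Lemma iter_shiftM a b k l f g :
  iter a (shift k) f = 0 -> iter b (shift l) g = 0 ->
  iter (a + b) (shift (k + l)) (f * g) = 0.
Proof.
move: {2}(a + b)%N (erefl (a + b)%N) => N.
elim: N a b f g => [|N IH] [|a] [|b] f g //= abN fa gb; rewrite -?iterS.
- by rewrite fa mul0r.
- by rewrite fa mul0r linear0.
- by rewrite gb mulr0 linear0.
- rewrite iterSr shiftM linearD /=.
  have {}abN : (a + b.+1)%N = N by move: abN; rewrite addSn => -[].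
  rewrite abN -{1}abN IH ?add0r -?iterSr //.
  have -> : N = (a.+1 + b)%N by rewrite addSnnS.
  by rewrite IH -?iterSr // addSnnS.
Qed.

Lemma iter_shift_linear_field k M i a :
  iter a (shift k) (linear_field M i) =
  linear_field (iter a (fun M => lin1_mx A *m M - k *: M) M) i.
Proof.
have step B : shift k (linear_field B i) = linear_field (lin1_mx A *m B - k *: B) i.
  have linE (C : 'M[K]_n) : linear_field C i = \sum_j C j i *: 'X_j by [].
  rewrite /eigen_shift {1}linE linear_sum /= [in k *: _]linE scaler_sumr linE.
  have -> : \sum_j flow_derivation A (B j i *: 'X_j) =
      \sum_j (lin1_mx A *m B) j i *: 'X_j.
    under eq_bigr => j _.
      rewrite linearZ /= /flow_derivation.
      under eq_bigr do rewrite dirdX mxE mulrC mul_mpolyC.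
      rewrite (bigD1 j) //= eqxx scale1r big1 => [|l lj]; last first.
        by rewrite eq_sym (negPf lj) scale0r.
      rewrite addr0 scaler_sumr.
      over.
    rewrite exchange_big /=; apply: eq_bigr => l _.
    rewrite mxE scaler_suml; apply: eq_bigr => j _.
    by rewrite scalerA mulrC.
  rewrite -sumrB; apply: eq_bigr => j _.
  by rewrite scalerA -scalerBl !mxE.
by elim: a => [//|a IH]; rewrite !iterS IH step.
Qed.

Lemma weighted_nilpotent k p : weighted k p -> exists a, iter a (shift k) p = 0.
Proof.
elim=> [l|c|l i l' q lr _ [a qa]|l q1 q2 _ [a qa] _ [b qb]].
- by exists 0%N.
- exists 1%N => /=; rewrite /eigen_shift scale0r subr0 /= /flow_derivation.
  by rewrite big1 // => i _; rewrite dirdC mulr0.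
- exists (m + a)%N; apply: iter_shiftM qa.
  by rewrite iter_shift_linear_field nilP // /linear_field big1 // => j _;
    rewrite mxE scale0r.
- exists (a + b)%N; rewrite linearD /= {1}addnC !iterD qa qb.
  by rewrite !linear0 addr0.
Qed.

Lemma weighted_sum k (J : Type) (s : seq J) (Q : pred J) (F : J -> {mpoly K[n]}) :
  (forall j, Q j -> weighted k (F j)) -> weighted k (\sum_(j <- s | Q j) F j).
Proof.
by move=> WF; elim/big_ind: _ => //; [exact: weighted0|exact: weightedD].
Qed.

Lemma weighted_components p : exists (s : seq K) (F : K -> {mpoly K[n]}),
  [/\ uniq s, forall k, weighted k (F k) & p = \sum_(k <- s) F k].
Proof.
suff [L WL ->] : exists2 L : seq (K * {mpoly K[n]}),
    {in L, forall t, weighted t.1 t.2} & p = \sum_(t <- L) t.2.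
  exists (undup [seq t.1 | t <- L]), (fun k => \sum_(t <- L | t.1 == k) t.2).
  split; first exact: undup_uniq.
    move=> k; rewrite big_seq_cond; apply: weighted_sum => t /andP[tL /eqP <-].
    exact: WL.
  rewrite (exchange_big_dep xpredT) //= big_seq [RHS]big_seq.
  apply: eq_bigr => t tL; rewrite -big_filter.
  have -> : [seq k <- undup [seq t.1 | t <- L] | t.1 == k] = [:: t.1].
    rewrite (eq_filter (a2 := pred1 t.1)) => [|k]; last by rewrite /= eq_sym.
    by rewrite filter_pred1_uniq ?undup_uniq // mem_undup map_f.
  by rewrite big_seq1.
elim/mpoly_algebra_ind: p => [c|i p [L WL ->]|p q [L WL ->] [L' WL' ->]].
- exists [:: (0, c%:MP)]; last by rewrite big_seq1.
  by move=> t; rewrite inE => /eqP ->; apply: weightedC.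
- have XiE : 'X_i = \sum_(l <- r) linear_field (P l) i.
    rewrite exchange_big /=.
    under eq_bigr => j _ do rewrite -scaler_suml -summxE sumP mxE.
    rewrite (bigD1 i) //= eqxx scale1r big1 ?addr0 // => j /negPf ->.
    by rewrite scale0r.
  exists [seq (l + t.1, linear_field (P l) i * t.2) | l <- r, t <- L].
    by move=> _ /allpairsP[[l t] /= [lr tL ->]]; apply: weightedX => //; apply: WL.
  rewrite big_allpairs_dep /= XiE mulr_suml; apply: eq_bigr => l _.
  by rewrite mulr_sumr.
- exists (L ++ L'); last by rewrite big_cat.
  by move=> t; rewrite mem_cat => /orP[/WL|/WL'].
Qed.

Lemma weighted_ideal_components (Z : set U) p : aut_cone Z A -> proj_variety Z ->
  cone_ideal Z p -> exists (s : seq K) (F : K -> {mpoly K[n]}),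
  [/\ forall k, weighted k (F k), forall k, cone_ideal Z (F k)
     & p = \sum_(k <- s) F k].
Proof.
move=> autA Zvar Ip; have [s [F [us WF pE]]] := weighted_components p.
have IF : {in s, forall k, cone_ideal Z (F k)}.
  apply: (@stable_eigen_components _ _ (flow_derivation A) (cone_ideal Z)) us _ _.
  - exact: cone_ideal0.
  - exact: cone_ideal_linear.
  - by move=> f; apply: flow_derivation_ideal.
  - by move=> k; apply: weighted_nilpotent.
  - by rewrite -pE.
exists s, (fun k => if k \in s then F k else 0); split=> [k|k|].
- by case: ifP => _; [exact: WF|exact: weighted0].
- by case: ifP => [/IF//|_]; apply: cone_ideal0.
- by rewrite pE; apply: eq_big_seq => k ->.
Qed.

(** [G] is a monoid of weights: a product of weight outside [G] has a factor of weight outside [G],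
    and that factor vanishes at [x]. *)
Lemma weighted_vanish (G : K -> Prop) k p x :
  G 0 -> (forall a b, G a -> G b -> G (a + b)) ->
  weighted k p -> {in r, forall l, ~ G l -> x *m P l = 0} -> ~ G k ->
  peval p x = 0.
Proof.
move=> G0 GD Wp xP; elim: Wp => [l|c|l i l' q lr _ IH|l q1 q2 _ IH1 _ IH2] NG.
- by rewrite peval0.
- by case: NG.
- rewrite pevalM; have [Gl|NGl] := pselect (G l).
    by rewrite IH ?mulr0 // => Gl'; apply/NG/GD.
  have := congr1 (fun y : U => y 0 i) (veval_linear (P l) x).
  by rewrite mxE xP // mxE => ->; rewrite mul0r.
- by rewrite pevalD IH1 ?IH2 ?addr0.
Qed.

(** Coordinates of nonzero weight vanish at [x]. In the derivative of a product the undifferentiated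
    factors must thus have weight 0, which leaves weight [k] for the differentiated one. *)
Lemma weighted_diff k p x v l : {in r, forall l', l' != 0 -> x *m P l' = 0} ->
  {in r &, forall l l', P l *m P l' = if l == l' then P l else 0} ->
  weighted k p -> l \in r -> l != k -> pdiff p x (v *m P l) = 0.
Proof.
move=> xP orth Wp lr; elim: Wp => [k'|c|l1 i k' q l1r Wq IH|k' q1 q2 _ IH1 _ IH2] lk.
- by rewrite pdiffE linear0 peval0.
- by rewrite pdiffC.
- have qx : k' != 0 -> peval q x = 0.
    move=> k'0; apply: (weighted_vanish (G := fun a => a = 0)) Wq _ _ => //.
    - by move=> a b -> ->; rewrite addr0.
    - by move=> a ar /eqP a0; apply: xP.
    - exact/eqP.
  have lx : l1 != 0 -> peval (linear_field (P l1) i) x = 0.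
    move=> l10; have := congr1 (fun y : U => y 0 i) (veval_linear (P l1) x).
    by rewrite mxE xP // mxE.
  rewrite pdiffM; have := congr1 (fun y : U => y 0 i) (vdiff_linear (P l1) x (v *m P l)).
  rewrite mxE -mulmxA orth // => ->.
  have [k'0|/qx ->] := eqVneq k' 0; last first.
    rewrite mulr0 add0r; have [l10|/lx ->] := eqVneq l1 0; last by rewrite mul0r.
    by rewrite IH ?mulr0 //; move: lk; rewrite l10 add0r.
  have -> : (l == l1) = false by apply: negbTE; move: lk; rewrite k'0 addr0.
  rewrite mulmx0 mxE mul0r add0r.
  have [l10|/lx ->] := eqVneq l1 0; last by rewrite mul0r.
  by rewrite IH ?mulr0 //; move: lk; rewrite l10 add0r.
- by rewrite pdiffD IH1 ?IH2 ?addr0.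
Qed.

End Weights.

Section OrthogonalIdempotents.
Variables (K : numClosedFieldType) (n : nat) (r : seq K) (P : K -> 'M[K]_n).
Hypothesis ur : uniq r.
Hypothesis orth :
  {in r &, forall l l', P l *m P l' = if l == l' then P l else 0}.

Definition spectral_sum (c : K -> K) : 'M[K]_n := \sum_(l <- r) c l *: P l.

Lemma spectral_sum_idem c l : l \in r -> spectral_sum c *m P l = c l *: P l.
Proof.
move=> lr; rewrite mulmx_suml (bigD1_seq l) //= -scalemxAl orth // eqxx.
rewrite big_seq_cond big1 ?addr0 // => k /andP[kr kl].
by rewrite -scalemxAl orth // (negPf kl) scaler0.
Qed.

Lemma idem_spectral_sum c l : l \in r -> P l *m spectral_sum c = c l *: P l.
Proof.
move=> lr; rewrite mulmx_sumr (bigD1_seq l) //= -scalemxAr orth // eqxx.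
rewrite big_seq_cond big1 ?addr0 // => k /andP[kr kl].
by rewrite -scalemxAr orth // eq_sym (negPf kl) scaler0.
Qed.

Lemma spectral_sumM c d :
  spectral_sum c *m spectral_sum d = spectral_sum (fun l => c l * d l).
Proof.
rewrite mulmx_sumr /spectral_sum big_seq [RHS]big_seq; apply: eq_bigr => l lr.
by rewrite -scalemxAr -/(spectral_sum c) spectral_sum_idem // scalerA mulrC.
Qed.

End OrthogonalIdempotents.

(** * From an infinitesimal to a multiplicative Euler action *)

Section EulerAction.
Variables (K : numClosedFieldType) (n : nat) (Z : set 'rV[K]_n).
Hypothesis Zvar : proj_variety Z.
Hypothesis Znondeg : nondegenerate_variety Z.
Local Notation U := 'rV[K]_n.
Local Notation I := (cone_ideal Z).
Local Notation T := (affine_tangent Z).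
Implicit Types (f g p : {mpoly K[n]}) (u v w x y z : U).
Variables (A : 'End(U)) (x : U) (nu : K).
Hypotheses (autA : aut_cone Z A) (Zx : Z x) (Ax : A x = 0) (nu0 : nu != 0).
Hypothesis Av : forall v, T x v -> exists c, A v = nu *: v + c *: x.

Lemma eigenvector_projection (P : K -> 'M[K]_n) m l k v :
  iter m (fun M => lin1_mx A *m M - l *: M) (P l) = 0 ->
  A v = k *: v -> l != k -> v *m P l = 0.
Proof.
move=> nilP Avk lk; have step a : v *m iter a (fun M => lin1_mx A *m M - l *: M) (P l)
    = (k - l) ^+ a *: (v *m P l).
  elim: a => [|a IH]; first by rewrite scale1r.
  rewrite iterS mulmxBr mulmxA mul_rV_lin1 /= Avk -scalemxAl -scalemxAr IH.
  by rewrite -scalerBl scalerA exprS.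
have := step m; rewrite nilP mulmx0 => /esym /eqP.
rewrite scaler_eq0 expf_eq0 subr_eq0 [k == l]eq_sym (negPf lk) andbF /=.
by move/eqP.
Qed.

Lemma tangent_eigenvector v : T x v -> exists c, A (v + c *: x) = nu *: (v + c *: x).
Proof.
move=> /Av[c vE]; exists (c / nu); rewrite linearD linearZ /= Ax scaler0 addr0 vE.
by rewrite scalerDr scalerA mulrCA divff // mulr1.
Qed.

Let multiple (k : K) : Prop := exists j : int, k = nu *~ j.

Let multiple0 : multiple 0.
Proof. by exists 0; rewrite mulr0z. Qed.

Let multipleD a b : multiple a -> multiple b -> multiple (a + b).
Proof. by move=> [i ->] [j ->]; exists (i + j); rewrite mulrzDr. Qed.

Let multiple_nu : multiple nu.
Proof. by exists 1; rewrite mulr1z. Qed.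

(* All eigenvalues of A are integral multiples of nu: an element of I whose
   differential at x is a linear form of another weight l may be chosen of
   weight l, hence vanishing where all coordinates of such weights vanish. *)
Lemma eigenvalues_multiple : exists (r : seq K) (P : K -> 'M[K]_n) (m : nat),
  [/\ uniq r /\ {in r, forall l, exists j : int, l = nu *~ j},
      \sum_(l <- r) P l = 1%:M,
      {in r &, forall l l', P l *m P l' = if l == l' then P l else 0} &
      {in r, forall l, iter m (fun M => lin1_mx A *m M - l *: M) (P l) = 0}].
Proof.
have [r [P [m [ur sumP orth nilP]]]] := spectral_decomposition (lin1_mx A).
have xP : {in r, forall l, l != 0 -> x *m P l = 0}.
  move=> l lr l0; apply: (eigenvector_projection (nilP l lr) _ l0).
  by rewrite Ax scale0r.
have TP v l : T x v -> l \in r -> ~ multiple l -> v *m P l = 0.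
  move=> Tv lr NGl; have [c eE] := tangent_eigenvector Tv.
  have l0 : l != 0 by apply/eqP => l0; apply: NGl; rewrite l0.
  have := eigenvector_projection (nilP l lr) eE.
  rewrite mulmxDl -scalemxAl xP // scaler0 addr0; apply.
  by apply/eqP => lnu; apply: NGl; rewrite lnu.
(* [PG] projects onto the generalized eigenspaces for multiples of [nu]. Its image contains [T_x] by
   [TP]; the aim is to show that it is everything. *)
pose G l := `[< multiple l >]; pose PG := spectral_sum r P (fun l => (G l)%:R).
have NG l : ~ multiple l -> G l = false by move=> H; apply/negbTE/asboolPn.
have GT l : multiple l -> G l by move=> H; apply/asboolP.
have PGPG : PG *m PG = PG.
  rewrite spectral_sumM //; apply: eq_bigr => l _.
  by case: (G l); rewrite ?mulr1 ?mulr0.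
have vPG v : v - v *m PG = \sum_(l <- r) (~~ G l)%:R *: (v *m P l).
  rewrite -{1}[v]mulmx1 -sumP -mulmxBr mulmxDr mulmxN !mulmx_sumr -sumrB.
  apply: eq_bigr => l _; rewrite -scalemxAr.
  by case: (G l); rewrite /= ?scale1r ?scale0r ?subrr ?subr0.
have TPG v : T x v -> v *m PG = v.
  move=> Tv; apply/eqP; rewrite eq_sym -subr_eq0 vPG big_seq big1 // => l lr.
  have [Gl|NGl] := pselect (multiple l); last by rewrite TP // scaler0.
  by rewrite GT // scale0r.
have xPG : x *m PG = x by apply/TPG/affine_tangent_self.
have form l i : l \in r -> ~ multiple l -> exists f,
    [/\ I f, forall y, peval f (y *m PG) = 0 & forall v, pdiff f x v = (v *m P l) 0 i].
  move=> lr NGl; have [|f If gradf] := @tangent_annihilator _ _ _ Zvar x (col i (P l))^T.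
    by move=> v Tv; rewrite trmxK colE mulmxA TP // mul0mx.
  have df v : pdiff f x v = (v *m P l) 0 i.
    by rewrite pdiff_grad gradf trmxK colE mulmxA -colE mxE.
  have [s [F [WF IF fE]]] := weighted_ideal_components sumP nilP autA Zvar If.
  (* Components of other weights have zero differential on the image of [P l], and [g] has zero
     differential on the other images; so [f] and [g] have the same differential at [x]. *)
  pose g := \sum_(k <- s | k == l) F k.
  have Wg : weighted r P l g by apply: weighted_sum => k /eqP <-.
  have dg v : pdiff g x v = (v *m P l) 0 i.
    have -> : pdiff g x v = pdiff g x (v *m P l).
      rewrite -{1}[v]mulmx1 -sumP mulmx_sumr pdiffE dird_suml peval_sum.
      rewrite (bigD1_seq l) //= -pdiffE big_seq_cond big1 ?addr0 // => k /andP[kr kl].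
      by rewrite -pdiffE; apply: (weighted_diff _ xP orth Wg).
    have -> : (v *m P l) 0 i = (v *m P l *m P l) 0 i by rewrite -mulmxA orth // eqxx.
    rewrite -df fE !pdiff_sum [RHS](bigID (fun k => k == l)) /=.
    rewrite [X in _ = _ + X]big1 ?addr0 //.
    by move=> k kl; apply: (weighted_diff _ xP orth (WF k)); rewrite // eq_sym.
  exists g; split=> //; first by apply: cone_ideal_sum => k _; apply: IF.
  move=> y; apply: (weighted_vanish multiple0 multipleD Wg) => // l' l'r NGl'.
  by rewrite -mulmxA spectral_sum_idem // NG // scale0r mulmx0.
have /choice[F FP] (li : K * 'I_n) : exists f,
    [/\ I f, forall y, peval f (y *m PG) = 0 &
     li.1 \in r -> ~ multiple li.1 -> forall v, pdiff f x v = (v *m P li.1) 0 li.2].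
  case: li => l i /=; have [lr|lr] := boolP (l \in r); last first.
    by exists 0; split=> // [|y]; [exact: cone_ideal0|rewrite peval0].
  have [Gl|NGl] := pselect (multiple l).
    by exists 0; split=> // [|y]; [exact: cone_ideal0|rewrite peval0].
  by have [f [If f0 df]] := form l i lr NGl; exists f; split.
have PG1 : 1%:M - PG = 0.
  apply: (nondegenerate_mx Znondeg) => z Zz; rewrite mulmxBr mulmx1.
  pose F' i := \sum_(l <- r) (~~ G l)%:R *: F (l, i).
  rewrite (@cone_in_subspace _ _ _ Zvar PG x F') ?subrr // => [i|i y|i v].
  - by apply: cone_ideal_sum => l _; apply: cone_idealZ; have [] := FP (l, i).
  - rewrite peval_sum big1 // => l _; have [_ F0 _] := FP (l, i).
    by rewrite pevalZ F0 mulr0.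
  - rewrite pdiff_sum vPG summxE big_seq [RHS]big_seq; apply: eq_bigr => l lr.
    rewrite pdiffZ mxE; have [Gl|NGl] := pselect (multiple l).
      by rewrite GT // !mul0r.
    by have [_ _ /= ->] := FP (l, i).
have PG0 l : l \in r -> ~ multiple l -> P l = 0.
  move=> lr NGl; rewrite -[P l]mulmx1 -[1%:M](subrK PG) PG1 add0r.
  by rewrite idem_spectral_sum // NG // scale0r.
exists (filter G r), P, m; split.
- split; first exact: filter_uniq.
  by move=> l; rewrite mem_filter => /andP[/asboolP].
- rewrite big_filter -sumP [RHS](bigID G) /= [X in _ = _ + X]big_seq_cond.
  rewrite [X in _ = _ + X]big1 ?addr0 // => l /andP[lr /asboolPn NGl].
  exact: PG0.
- move=> l l'; rewrite !mem_filter => /andP[_ lr] /andP[_ l'r].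
  exact: orth.
- by move=> l; rewrite mem_filter => /andP[_]; apply: nilP.
Qed.

(** [A] may have a nilpotent part; its semisimple part, with [nu] rescaled to 1, is what [rho]
    integrates. The ideal is preserved because the weight components of an equation are
    equations. *)
Lemma euler_action : exists2 rho,
  multiplicative_subgroup rho & Euler_action_at Z x rho.
Proof.
have [r [P [m [[ur mult] sumP orth nilP]]]] := eigenvalues_multiple.
(* The default exponent 0 is harmless: a polynomial of a weight that is not a multiple of [nu]
   vanishes everywhere. *)
have /choice[E EP] (k : K) : exists j : int, multiple k -> k = nu *~ j.
  have [[j kj]|Nk] := pselect (multiple k); first by exists j.
  by exists 0 => /Nk.
have Eeq k j : k = nu *~ j -> E k = j.
  move=> kj; apply/eqP; rewrite -subr_eq0; apply/eqP.
  have : nu *~ (E k - j) = 0 by rewrite mulrzBr -kj -EP ?subrr //; exists j.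
  by move/eqP; rewrite mulrz_eq0 (negPf nu0) orbF => /eqP.
have E0 : E 0 = 0 by apply: Eeq; rewrite mulr0z.
have Enu : E nu = 1 by apply: Eeq; rewrite mulr1z.
have ED a b : multiple a -> multiple b -> E (a + b) = E a + E b.
  by move=> Ga Gb; apply: Eeq; rewrite mulrzDr -!EP.
pose R t := spectral_sum r P (fun l => t ^ E l).
pose rho t : 'End(U) := linfun (mulmxr (R t)).
have rhoE t v : rho t v = v *m R t by rewrite lfunE.
have R1 : R 1 = 1%:M.
  by rewrite /R /spectral_sum -sumP; apply: eq_bigr => l _; rewrite exp1rz scale1r.
have RM s t : s != 0 -> t != 0 -> R (s * t) = R t *m R s.
  move=> s0 t0; rewrite spectral_sumM //; apply: eq_bigr => l _.
  by rewrite expfzMl mulrC.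
have RP t l : l \in r -> R t *m P l = t ^ E l *: P l.
  by move=> lr; rewrite spectral_sum_idem.
exists rho.
- split.
  + by apply/lfunP => v; rewrite rhoE R1 mulmx1 lfunE.
  + by move=> s t s0 t0; apply/lfunP => v; rewrite comp_lfunE !rhoE RM // mulmxA.
  (* [N] bounds all [|E l|], so the exponents [N + E l] range from 0 to [2 N]: this takes [2 N + 1]
     coefficients. *)
  + pose N := (\sum_(l <- r) `|E l|)%N.
    have EN l : l \in r -> (0 <= N%:Z + E l) && (N%:Z + E l < (N + N).+1%:Z).
      move=> lr; have : (`|E l| <= N)%N by rewrite /N (bigD1_seq l) //= leq_addr.
      by move=> H; apply/andP; split; lia.
    exists N, (N + N).+1,
      (fun k => \sum_(l <- r | N%:Z + E l == k%:Z) linfun (mulmxr (P l))).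
    move=> t t0; apply/lfunP => v; rewrite scale_lfunE rhoE sum_lfunE mulmx_sumr.
    rewrite scaler_sumr; under [RHS]eq_bigr do rewrite scale_lfunE sum_lfunE scaler_sumr.
    rewrite (exchange_big_dep xpredT) //= big_seq [RHS]big_seq; apply: eq_bigr => l lr.
    have /andP[] := EN l lr; case kE : (N%:Z + E l) => [k|//] _ klt.
    rewrite (bigD1 (Ordinal (klt : (k < (N + N).+1)%N))) //= big1 ?addr0 => [|j].
      rewrite lfunE /= -scalemxAr scalerA; congr (_ *: _).
      by rewrite /= !exprnP -kE expfzDr.
    by case/andP => /eqP [kj]; rewrite -val_eqE /= kj eqxx.
- move=> t t0; split=> [z Zz|].
  + have Wrho k p y : weighted r P k p -> peval p (y *m R t) = t ^ E k * peval p y.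
      elim=> [l|c|l i k' q lr Wq IH|k' q1 q2 _ IH1 _ IH2].
      * by rewrite !peval0 mulr0.
      * by rewrite !pevalC E0 mul1r.
      * have linP w : peval (linear_field (P l) i) w = (w *m P l) 0 i.
          by rewrite -veval_linear mxE.
        have Gl := mult l lr; have [Gk|NGk] := pselect (multiple k').
          rewrite !pevalM !linP IH ED // expfzDr // -mulmxA RP // -scalemxAr mxE.
          by rewrite mulrACA.
        have q0 w : peval q w = 0.
          apply: (weighted_vanish multiple0 multipleD Wq) => // l' l'r Nl'.
          by case: Nl'; apply: mult.
        by rewrite !pevalM !q0 !mulr0.
      * by rewrite !pevalD IH1 IH2 mulrDr.
    rewrite rhoE; apply: (cone_closed Zvar) => [|f If].
      apply: contraNneq (cone_neq0 Zvar Zz) => zR.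
      by rewrite -[z]mulmx1 -R1 -(mulVf t0) RM ?invr_eq0 // mulmxA zR mul0mx.
    have [s [F [WF IF ->]]] := weighted_ideal_components sumP nilP autA Zvar If.
    by rewrite peval_sum big1 // => k _; rewrite (Wrho _ _ _ (WF k)) IF // mulr0.
  + have eig k v : A v = k *: v -> rho t v = t ^ E k *: v.
      move=> vE; rewrite rhoE mulmx_sumr -[in RHS](mulmx1 v) -sumP mulmx_sumr.
      rewrite scaler_sumr big_seq [RHS]big_seq; apply: eq_bigr => l lr.
      have [->|lk] := eqVneq l k; first by rewrite scalemxAr.
      by rewrite -scalemxAr (eigenvector_projection (nilP l lr) vE) // !scaler0.
    have rx : rho t x = x by rewrite (eig 0) ?E0 ?scale1r // Ax scale0r.
    exists 1; rewrite rx scale1r; split=> // v Tv; rewrite mulr1.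
    have [c /eig] := tangent_eigenvector Tv; rewrite Enu expr1z linearD linearZ /= rx.
    move=> /(canRL (addrK _)) ->; exists (t * c - c).
    by rewrite scalerDr scalerA scalerBl addrA.
Qed.

End EulerAction.

(** * The linear form theta *)

Lemma bilinear_hom (K : fieldType) (V1 V2 W : vectType K) (b : V1 -> V2 -> W) :
  (forall y, linear (b^~ y)) -> (forall x, linear (b x)) ->
  exists h : 'Hom(V1, 'Hom(V2, W)), forall x y, h x y = b x y.
Proof.
move=> bl br; have /choice[g gE] x := linear_hom (br x).
have [|h hE] := @linear_hom K V1 'Hom(V2, W) g; last by exists h => x y; rewrite hE gE.
by move=> c x y; apply/lfunP => z; rewrite add_lfunE scale_lfunE !gE bl.
Qed.

Section Theta.
Variables (K : numClosedFieldType) (n : nat) (Z : set 'rV[K]_n).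
Hypothesis Zvar : proj_variety Z.
Variable r : nat.
Hypothesis Tdim : forall z, Z z -> has_vdim (affine_tangent Z z) r.
Hypothesis Znondeg : nondegenerate_variety Z.
Hypothesis Znormal : linearly_normal Z.
Hypothesis ZneqPU : Z <> projective_space.
Local Notation U := 'rV[K]_n.
Local Notation T := (affine_tangent Z).
Local Notation X := (partial_inv_Xi0 Z).
Implicit Types (u v x y z : U) (h : 'Hom(U, 'End(U))) (f : 'Hom(U, K^o)).

Lemma form_inj f f' : (forall z, Z z -> f z = f' z) -> f = f'.
Proof.
move=> ff'; apply/eqP; rewrite -subr_eq0; apply/eqP/Znondeg => z Zz.
by rewrite add_lfunE opp_lfunE ff' // subrr.
Qed.

Lemma partial_inv_tangent h z v : X h -> Z z -> T z v -> h z v = h v z.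
Proof.
move=> [_ [_ Xh]] Zz Tv; have := Xh z v Zz Tv.
by rewrite partialE => /eqP; rewrite subr_eq0 => /eqP.
Qed.

(** For tangent [v] the condition on [partial h] turns the differential of [z |-> h z z] along [v]
    into [2 h v z], which is tangent because [h v] is an infinitesimal automorphism. *)
Lemma partial_inv_diag h : X h -> forall z, Z z -> exists c, h z z = c *: z.
Proof.
move=> Xh z Zz; have autH : Hom_aut Z h by case: Xh.
pose q := quad_field (fun x y => h x y).
have qE x : veval q x = h x x.
  by apply: veval_quad; [exact: hom_linear_l|exact: hom_linear_r].
have dqE x v : vdiff q x v = h x v + h v x.
  by apply: vdiff_quad; [exact: hom_linear_l|exact: hom_linear_r].
rewrite -qE; apply: (tangent_field_proportional Zvar Tdim Znondeg (d := 2)) => //.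
- exact: dhomog_quad.
- by move=> y Zy; rewrite qE; apply: autH.
- move=> y v Zy Tv; rewrite dqE (partial_inv_tangent Xh Zy Tv).
  by apply: affine_tangentD; apply: autH.
Qed.

Lemma theta_unique h f : (forall z, Z z -> h z z = (f z : K) *: z) -> theta Z h = f.
Proof.
move=> hf; rewrite /theta; case: xgetP => [g _ hg|/(_ f) //].
apply: form_inj => z Zz; have := hf z Zz; rewrite hg // => /eqP.
rewrite -subr_eq0 -scalerBl scaler_eq0 subr_eq0.
by rewrite (negPf (cone_neq0 Zvar Zz)) orbF => /eqP.
Qed.

(** Where [z_i] is nonzero, the factor of proportionality is the [i]-th coordinate of [h z z], a
    quadric, divided by [z_i]: a section of O(1). *)
Lemma thetaE h : X h -> forall z, Z z -> h z z = (theta Z h z : K) *: z.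
Proof.
move=> Xh; have /choice[s sP] z : exists c, Z z -> h z z = c *: z.
  by have [/(partial_inv_diag Xh)[c]|NZ] := pselect (Z z); [exists c|exists 0].
have sec : section_O1 Z s.
  move=> z Zz; have /rV0Pn[i zi] := cone_neq0 Zvar Zz.
  exists 1%N, (quad_field (fun x y => h x y) i), 'X_i; split.
  - exact: dhomog_quad.
  - exact: dhomog_coord.
  - by rewrite pevalX.
  - move=> u Zu; rewrite pevalX => ui; apply: (mulIf ui); rewrite divfK //.
    have := congr1 (fun a : U => a 0 i)
      (veval_quad (hom_linear_l h) (hom_linear_r h) u).
    by rewrite sP // !mxE.
have [f [fs _]] := Znormal sec.
have hf z : Z z -> h z z = (f z : K) *: z by move=> Zz; rewrite sP // fs.
by rewrite (theta_unique hf).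
Qed.

Lemma partial_linear : linear (@partial K n).
Proof.
move=> c h h'; apply/lfunP => u; apply/lfunP => v.
by rewrite !(add_lfunE, scale_lfunE, partialE) scalerBr opprD addrACA.
Qed.

HB.instance Definition _ :=
  GRing.isLinear.Build K 'Hom(U, 'End(U)) 'Hom(U, 'End(U)) _ (@partial K n)
    partial_linear.

Lemma partial_inv_linear c h h' : X h -> X h' -> X (c *: h + h').
Proof.
move=> [aH [_ XH]] [aH' [_ XH']]; split=> [u z Zz|].
  rewrite !(add_lfunE, scale_lfunE).
  by apply: affine_tangentD; [apply/affine_tangentZ/aH|apply: aH'].
split=> [u|z v Zz Tv]; first by rewrite partialE subrr.
by rewrite partial_linear !(add_lfunE, scale_lfunE) XH // XH' // scaler0 addr0.
Qed.

Lemma partial_inv0 : X 0.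
Proof.
split=> [u z Zz|]; first by rewrite !zero_lfunE; apply: affine_tangent0.
split=> [u|z v Zz Tv]; first by rewrite partialE subrr.
by rewrite partialE !zero_lfunE subrr.
Qed.

Lemma partial_inv_sum (J : finType) (c : J -> K) (F : J -> 'Hom(U, 'End(U))) :
  (forall j, X (F j)) -> X (\sum_j c j *: F j).
Proof.
move=> XF; elim/big_rec: _ => [|j h _ Xh]; first exact: partial_inv0.
exact: partial_inv_linear.
Qed.

Lemma theta_linear c h h' : X h -> X h' ->
  theta Z (c *: h + h') = c *: theta Z h + theta Z h'.
Proof.
move=> Xh Xh'; apply: theta_unique => z Zz.
by rewrite !(add_lfunE, scale_lfunE) !thetaE // scalerDl scalerA.
Qed.

Lemma theta0 : theta Z 0 = 0.
Proof. by apply: theta_unique => z _; rewrite !zero_lfunE scale0r. Qed.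

Lemma theta_sum (J : finType) (c : J -> K) (F : J -> 'Hom(U, 'End(U))) :
  (forall j, X (F j)) ->
  theta Z (\sum_j c j *: F j) = \sum_j c j *: theta Z (F j).
Proof.
move=> XF; suff [] : X (\sum_j c j *: F j) /\
  theta Z (\sum_j c j *: F j) = \sum_j c j *: theta Z (F j) by [].
elim/big_rec2: _ => [|j f h _ [Xh <-]].
  by split; [exact: partial_inv0|exact: theta0].
by split; [exact: partial_inv_linear|rewrite theta_linear].
Qed.

(** Polarization of [h x x - theta(x) x], which vanishes on [Z], combined with [h z v = h v z] for
    tangent [v]. *)
Lemma theta_polar h z v : X h -> Z z -> T z v ->
  2%:R *: h z v = (theta Z h v : K) *: z + (theta Z h z : K) *: v.
Proof.
move=> Xh Zz Tv.
pose B x y := h x y - (theta Z h x : K) *: y.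
have Bl y : linear (B^~ y).
  move=> c x x'; rewrite /B hom_linear_l.
  have -> : (theta Z h (c *: x + x') : K) = c * theta Z h x + theta Z h x'.
    by rewrite linearP.
  by rewrite scalerDl -scalerA scalerBr opprD addrACA.
have Br x : linear (B x).
  move=> c y y'; rewrite /B linearP scalerDr opprD addrACA !scalerA mulrC.
  by rewrite -scalerA -scalerBr.
have BZ y : Z y -> B y y = 0 by move=> Zy; rewrite /B thetaE // subrr.
have := quad_polar Bl Br BZ Zvar Tv.
rewrite /B -(partial_inv_tangent Xh Zz Tv) addrACA -opprD => /eqP.
by rewrite subr_eq0 scaler_nat mulr2n addrC => /eqP ->; rewrite addrC.
Qed.

Lemma theta0_Utilde h : X h -> theta Z h = 0 -> Utilde Z h.
Proof.
move=> Xh th0; split=> [|u Zu]; first by case: Xh.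
split=> [|v Tv]; first by rewrite thetaE // th0 zero_lfunE scale0r.
exists 0; rewrite scale0r; have := theta_polar Xh Zu Tv.
rewrite th0 !zero_lfunE !scale0r addr0 => /eqP.
by rewrite scaler_eq0 pnatr_eq0 => /eqP.
Qed.

Lemma symmetric_theta_inj h : X h -> partial h = 0 -> theta Z h = 0 -> h = 0.
Proof.
move=> Xh ph0 th0; apply: (prolongation_zero Zvar Tdim Znondeg).
- by case: Xh.
- move=> x y; have := congr1 (fun s : 'Hom(U, 'End(U)) => s x y) ph0.
  by rewrite partialE !zero_lfunE => /eqP; rewrite subr_eq0 => /eqP.
- by move=> z Zz; rewrite thetaE // th0 zero_lfunE scale0r.
Qed.

(** The excluded closed set is the hyperplane where theta vanishes; by non-degeneracy it does not
    contain [Z]. Subtracting [theta(x)] from [h x] makes it kill [x], as [euler_action] requires. *)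
Lemma euler_of_theta h : X h -> theta Z h <> 0 -> Euler_symmetric Z.
Proof.
move=> Xh thN0; pose th := theta Z h.
pose p : {mpoly K[n]} := \sum_i (th (delta_mx 0 i) : K) *: 'X_i.
have pE u : peval p u = th u.
  rewrite {2}(row_sum_delta u) linear_sum peval_sum; apply: eq_bigr => i _.
  by rewrite pevalZ pevalX linearZ mulrC.
exists [set u | u != 0 /\ th u = 0]; split.
- exists [set p]; split=> [_ ->|u].
    by exists 1%N; apply: rpred_sum => i _; apply/rpredZ/dhomog_coord.
  split=> [[u0 tu]|[u0 pu]]; first by split=> // _ ->; rewrite pE.
  by split=> //; rewrite -pE; apply: pu.
- by move=> ZW; apply: thN0; apply: Znondeg => z /ZW[].
- move=> x Zx Wx; have x0 := cone_neq0 Zvar Zx.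
  have tx : (th x : K) != 0 by apply/eqP => tx; apply: Wx.
  pose A : 'End(U) := h x - (th x : K) *: \1%VF.
  have AE v : A v = h x v - (th x : K) *: v.
    by rewrite add_lfunE opp_lfunE scale_lfunE id_lfunE.
  have n2 : (2%:R : K) != 0 by rewrite pnatr_eq0.
  apply: (@euler_action _ _ _ Zvar Znondeg A x (- (th x : K) / 2%:R)) => //.
  + move=> z Zz; rewrite AE; apply: affine_tangentB; first by case: Xh => aH _; apply: aH.
    exact/affine_tangentZ/affine_tangent_self.
  + by rewrite AE thetaE // subrr.
  + by rewrite mulf_neq0 ?oppr_eq0 ?invr_eq0.
  + move=> v Tv; exists ((th v : K) / 2%:R); rewrite AE.
    apply: (scalerI n2); rewrite scalerBr (theta_polar Xh Zx Tv) -/th.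
    rewrite scalerDr !scalerA ![2%:R * (_ / _)]mulrC !divfK //.
    rewrite mulrDl mul1r scalerDl opprD -addrA [X in _ + X]addrA subrr add0r.
    by rewrite addrC scaleNr.
Qed.

Lemma Xi0_form s i : Xi0 Z s ->
  exists2 w, wedge2 Z w & forall u v, w u v = s u v 0 i :> K.
Proof.
move=> [alt sT].
have [||w wE] := @bilinear_hom K U U K^o (fun u v => s u v 0 i).
- by move=> y c x x'; rewrite hom_linear_l !mxE.
- by move=> x c y y'; rewrite linearP !mxE.
exists w => [|u v]; last exact: wE.
split=> [u|z v Zz Tv]; first by rewrite wE alt mxE.
by rewrite wE sT // mxE.
Qed.

Lemma tensor_exists (w : 'Hom(U, 'Hom(U, K^o))) (e : U) :
  exists s : 'Hom(U, 'End(U)), forall u v, s u v = (w u v : K) *: e.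
Proof.
apply: (@bilinear_hom K U U U (fun u v => (w u v : K) *: e)).
- move=> y c x x'.
  have -> : (w (c *: x + x') y : K) = c * w x y + w x' y.
    by rewrite linearP /= add_lfunE scale_lfunE.
  by rewrite scalerDl -scalerA.
- move=> x c y y'; have -> : (w x (c *: y + y') : K) = c * w x y + w x y'.
    by rewrite linearP.
  by rewrite scalerDl -scalerA.
Qed.

Lemma tensor_Xi0 (w : 'Hom(U, 'Hom(U, K^o))) (e : U) (s : 'Hom(U, 'End(U))) :
  wedge2 Z w -> (forall u v, s u v = (w u v : K) *: e) -> Xi0 Z s.
Proof.
move=> [alt wT] sE; split=> [u|z v Zz Tv]; first by rewrite sE alt scale0r.
by rewrite sE wT // scale0r.
Qed.

Lemma symmetric_prolongation h : X h -> partial h = 0 -> first_prolongation Z h.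
Proof.
move=> Xh ph0; split=> [|x y]; first by case: Xh.
have := congr1 (fun s : 'Hom(U, 'End(U)) => s x y) ph0.
by rewrite partialE !zero_lfunE => /eqP; rewrite subr_eq0 => /eqP.
Qed.

Lemma prolongation_partial h : first_prolongation Z h -> X h /\ partial h = 0.
Proof.
move=> [aH hC]; have ph0 : partial h = 0.
  apply/lfunP => x; apply/lfunP => y.
  by rewrite partialE hC subrr !zero_lfunE.
split=> //; split=> //; rewrite ph0.
by split=> [u|z v _ _]; rewrite !zero_lfunE.
Qed.

Lemma surjective_euler_or_iso : set_surj X (Xi0 Z) partial ->
  Euler_symmetric Z \/ is_linear_iso (Utilde Z `&` X) (Xi0 Z) partial.
Proof.
move=> surj; have [[h [Xh thN0]]|N] := pselect (exists h, X h /\ theta Z h <> 0).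
  by left; apply: euler_of_theta thN0.
have th0 h : X h -> theta Z h = 0.
  by move=> Xh; apply: contrapT => thN0; apply: N; exists h.
right; split; last by move=> c h h' _ _; rewrite partial_linear.
split.
- by move=> h [_ []].
- move=> h h' /set_mem[_ Xh] /set_mem[_ Xh'] hh'.
  have XB : X (h - h') by rewrite addrC -scaleN1r; apply: partial_inv_linear.
  apply/eqP; rewrite -subr_eq0; apply/eqP/symmetric_theta_inj => //; last exact: th0.
  by rewrite linearB /= hh' subrr.
- move=> s /surj[h Xh <-]; exists h => //; split=> //.
  exact/theta0_Utilde/th0.
Qed.

(** * Dimension count when theta is injective *)

Section ZeroUtilde.
Hypothesis Utilde0 : Utilde Z `&` X = [set 0].

Lemma theta_inj0 h : X h -> theta Z h = 0 -> h = 0.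
Proof.
move=> Xh th0; have : (Utilde Z `&` X) h by split=> //; apply: theta0_Utilde.
by rewrite Utilde0.
Qed.

Lemma tangentially_nondegenerate_surj : tangentially_nondegenerate Z ->
  set_surj X (Xi0 Z) partial.
Proof.
move=> wedge0 s Xs; exists 0; first exact: partial_inv0.
rewrite linear0; apply/esym/lfunP => u; apply/lfunP => v; apply/rowP => i.
have [w] := Xi0_form i Xs; rewrite wedge0 => -> <-.
by rewrite !zero_lfunE mxE.
Qed.

(** A generator of [wedge2] identifies [Xi0] with [U], and [theta] identifies the domain with the
    dual of [U]. So [partial] becomes a square matrix [M], injective because its kernel consists of
    symmetric [h]. *)
Lemma theta_iso_surj : first_prolongation Z = [set 0] ->
  is_linear_iso X [set: 'Hom(U, K^o)] (theta Z) -> has_vdim (wedge2 Z) 1 ->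
  set_surj X (Xi0 Z) partial.
Proof.
move=> prol0 [[_ _ thsurj] _] [S [SP dS]].
pose w := vpick S.
have Sw : S = <[w]>%VS.
  apply/esym/eqP; rewrite eqEdim dS dim_vline vpick0 -memvE memv_pick /=.
  by rewrite -dimv_eq0 dS.
have wedgew w' : wedge2 Z w' -> exists c, w' = c *: w.
  by move=> /SP; rewrite Sw => /vlineP.
have Xi0w s : Xi0 Z s -> exists e : U, forall u v, s u v = (w u v : K) *: e.
  move=> Xs; have /choice[c cP] i : exists c : K, forall u v, s u v 0 i = c * w u v.
    have [w' /wedgew[c ->] E] := Xi0_form i Xs; exists c => u v.
    by rewrite -E !scale_lfunE.
  exists (\row_i c i) => u v; apply/rowP => i.
  by rewrite !mxE cP mulrC.
have /choice[H HP] i : exists h, X h /\ forall u, theta Z h u = u 0 i.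
  have [f fE] := @linear_hom K U K^o (fun u : U => u 0 i)
    (fun c x y => etrans (mxE _ _ _ _)
    (congr1 (+%R^~ (y 0 i)) (mxE _ _ _ _))).
  have /thsurj[h Xh hE] : [set: 'Hom(U, K^o)] f by [].
  by exists h; split=> // u; rewrite hE.
have XH i : X (H i) by have [] := HP i.
have /choice[e eP] i : exists e : U, forall u v, partial (H i) u v = (w u v : K) *: e.
  by apply: Xi0w; case: (XH i).
pose M := \matrix_i e i.
have partialH (c : U) u v :
    partial (\sum_i c 0 i *: H i) u v = (w u v : K) *: (c *m M).
  rewrite linear_sum !sum_lfunE mulmx_sum_row scaler_sumr; apply: eq_bigr => i _.
  by rewrite linearZ /= !scale_lfunE eP rowK !scalerA mulrC.
have Mfree : row_free M.
  apply: inj_row_free => c cM; have H0 : \sum_i c 0 i *: H i = 0.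
    have : first_prolongation Z (\sum_i c 0 i *: H i).
      apply: symmetric_prolongation; first exact: partial_inv_sum.
      by apply/lfunP => u; apply/lfunP => v; rewrite partialH cM scaler0 !zero_lfunE.
    by rewrite prol0.
  apply/rowP => j; have := congr1 (fun f : 'Hom(U, K^o) => f (delta_mx 0 j))
    (theta_sum (fun i => c 0 i) XH).
  rewrite H0 theta0 sum_lfunE zero_lfunE mxE => ->.
  rewrite (bigD1 j) //= scale_lfunE big1 => [|i ij].
    by have [_ ->] := HP j; rewrite mxE !eqxx addr0 /GRing.scale /= mulr1.
  by rewrite scale_lfunE; have [_ ->] := HP i; rewrite mxE (negPf ij) andbF scaler0.
move=> s /Xi0w[a sE].
have Munit : M \in unitmx by rewrite -row_free_unit.
exists (\sum_i (a *m invmx M) 0 i *: H i); first exact: partial_inv_sum.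
apply/lfunP => u; apply/lfunP => v.
by rewrite partialH mulmxKV // sE.
Qed.

(** Surjectivity lifts the tensors of [w] with the [n] basis vectors to independent elements [H i].
    As [theta] is injective into a space of dimension [n], they span the domain. Hence [Xi0]
    consists of tensors of [w], and [partial] is injective. *)
Lemma surj_theta_iso (w : 'Hom(U, 'Hom(U, K^o))) : wedge2 Z w -> w != 0 ->
  set_surj X (Xi0 Z) partial ->
  [/\ Euler_symmetric Z, first_prolongation Z = [set 0],
      is_linear_iso X [set: 'Hom(U, K^o)] (theta Z) & has_vdim (wedge2 Z) 1].
Proof.
move=> Ww w0 surj.
have partial_tensor (w' : 'Hom(U, 'Hom(U, K^o))) e : wedge2 Z w' ->
    exists h, X h /\ forall u v, partial h u v = (w' u v : K) *: e.
  move=> Ww'; have [s sE] := tensor_exists w' e.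
  by have [h Xh hs] := surj s (tensor_Xi0 Ww' sE); exists h; rewrite hs.
have /choice[H HP] (i : 'I_n) := partial_tensor w (delta_mx 0 i) Ww.
have XH i : X (H i) by have [] := HP i.
pose comb (c : U) := \sum_i c 0 i *: H i.
have Xcomb c : X (comb c) by apply: partial_inv_sum.
have partial_comb c u v : partial (comb c) u v = (w u v : K) *: c.
  rewrite /comb linear_sum !sum_lfunE [in RHS](row_sum_delta c) scaler_sumr.
  apply: eq_bigr => i _; rewrite linearZ /= !scale_lfunE.
  by have [_ ->] := HP i; rewrite !scalerA mulrC.
have [u0 [v0 w00]] : exists u0 v0, (w u0 v0 : K) != 0.
  apply: contrapT => N; move/eqP: w0; apply; apply/lfunP => u; apply/lfunP => v.
  rewrite !zero_lfunE; apply: contrapT => /eqP wuv; apply: N.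
  by exists u, v.
have comb_inj c : comb c = 0 -> c = 0.
  move=> c0; have := partial_comb c u0 v0.
  rewrite c0 linear0 !zero_lfunE => /esym/eqP.
  by rewrite scaler_eq0 (negPf w00) => /eqP.
pose M := \matrix_(i, j) (theta Z (H i) (delta_mx 0 j) : K).
have theta_comb c j : theta Z (comb c) (delta_mx 0 j) = (c *m M) 0 j.
  rewrite theta_sum // sum_lfunE mxE; apply: eq_bigr => i _.
  by rewrite scale_lfunE mxE.
have form_ext (f f' : 'Hom(U, K^o)) :
    (forall j, f (delta_mx 0 j) = f' (delta_mx 0 j)) -> f = f'.
  move=> ff'; apply/lfunP => u; rewrite (row_sum_delta u) !linear_sum.
  by apply: eq_bigr => j _; rewrite !linearZ /= ff'.
have Mfree : row_free M.
  apply: inj_row_free => c cM; apply/comb_inj/theta_inj0 => //.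
  by apply: form_ext => j; rewrite theta_comb cM mxE zero_lfunE.
have theta_onto f : exists c, theta Z (comb c) = f.
  exists ((\row_j (f (delta_mx 0 j) : K)) *m invmx M); apply: form_ext => j.
  by rewrite theta_comb mulmxKV ?mxE // -row_free_unit.
have theta_eq h h' : X h -> X h' -> theta Z h = theta Z h' -> h = h'.
  move=> Xh Xh' hh'; apply/eqP; rewrite -subr_eq0; apply/eqP/theta_inj0.
    by rewrite addrC -scaleN1r; apply: partial_inv_linear.
  by rewrite addrC -scaleN1r theta_linear // scaleN1r hh' addNr.
have X_comb h : X h -> exists c, h = comb c.
  by move=> Xh; have [c ch] := theta_onto (theta Z h); exists c; apply: theta_eq.
have [z Zz] := cone_nonempty Zvar.
have /rV0Pn[i0 _] := cone_neq0 Zvar Zz.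
split.
- have [f f0] : exists f : 'Hom(U, K^o), f <> 0.
    apply: contrapT => N; have a0 (a : U) : a = 0.
      apply/comb_inj/theta_inj0 => //.
      by apply: contrapT => aN; apply: N; exists (theta Z (comb a)).
    by have := cone_neq0 Zvar Zz; rewrite (a0 z) eqxx.
  have [c cf] := theta_onto f; apply: (@euler_of_theta (comb c)) => //.
  by rewrite cf.
- apply/seteqP; split=> [h /prolongation_partial[Xh ph0]|_ ->] /=.
    have [c hc] := X_comb h Xh; rewrite hc; apply: theta_inj0 => //.
    have -> : c = 0.
      have := partial_comb c u0 v0; rewrite -hc ph0 !zero_lfunE => /esym/eqP.
      by rewrite scaler_eq0 (negPf w00) => /eqP.
    by rewrite /comb big1 ?theta0 // => i _; rewrite mxE scale0r.
  split=> [u z' _|u v]; last by rewrite !zero_lfunE.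
  by rewrite !zero_lfunE; apply: affine_tangent0.
- split; last by move=> c h h' Xh Xh'; apply: theta_linear.
  split=> [//|h h' /set_mem Xh /set_mem Xh'|f _]; first exact: theta_eq.
  by have [c cf] := theta_onto f; exists (comb c).
- exists <[w]>%VS; split; last by rewrite dim_vline w0.
  move=> w'; split=> [/vlineP[c ->]|Ww'].
    have [alt wT] := Ww; split=> [u|z' v Zz' Tv].
      by rewrite !scale_lfunE alt scaler0.
    by rewrite !scale_lfunE wT // scaler0.
  have [h [Xh hE]] := partial_tensor w' (delta_mx 0 i0) Ww'.
  have [c hc] := X_comb h Xh; apply/vlineP; exists (c 0 i0).
  apply/lfunP => u; apply/lfunP => v; rewrite !scale_lfunE.
  have := congr1 (fun a : U => a 0 i0) (hE u v).
  by rewrite hc partial_comb !mxE !eqxx mulr1 mulrC => <-.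
Qed.

End ZeroUtilde.
End Theta.

Theorem corollary4p14 (R : realType) (n : nat) (Z : set 'rV[R[i]]_n)
  (Zvar : proj_variety Z) (Zsmooth : smooth_variety Z)
  (Znondeg : nondegenerate_variety Z) (Znormal : linearly_normal Z)
  (ZneqPU : Z <> projective_space) :
  (set_surj (partial_inv_Xi0 Z) (Xi0 Z) partial ->
     Euler_symmetric Z \/
     is_linear_iso (Utilde Z `&` partial_inv_Xi0 Z) (Xi0 Z) partial)
  /\
  (Utilde Z `&` partial_inv_Xi0 Z = [set 0] ->
     (set_surj (partial_inv_Xi0 Z) (Xi0 Z) partial <->
        [\/ tangentially_nondegenerate Z,
            [/\ Euler_symmetric Z, tangentially_nondegenerate Z &
                first_prolongation Z <> [set 0]] |
            [/\ Euler_symmetric Z, first_prolongation Z = [set 0],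
                is_linear_iso (partial_inv_Xi0 Z) [set: 'Hom('rV[R[i]]_n, R[i]^o)]
                  (theta Z) &
                has_vdim (wedge2 Z) 1]])).
Proof.
have [d _ Tdim] := Zsmooth.
pose K : numClosedFieldType := R[i].
split; first exact: (@surjective_euler_or_iso K n Z Zvar _ Tdim).
move=> Utilde0; split=> [surj|[tn|[_ tn _]|[_ prol0 iso dim1]]].
- have [tn|Ntn] := pselect (tangentially_nondegenerate Z); first exact: Or31.
  have [w [Ww w0]] : exists w, wedge2 Z w /\ w != 0.
    apply: contrapT => N; apply: Ntn; apply/seteqP; split=> [w Ww|_ ->].
      by apply: contrapT => /eqP w0; apply: N; exists w.
    by split=> [u|z v _ _]; rewrite !zero_lfunE.
  by apply: Or33; apply: (@surj_theta_iso K n Z Zvar _ Tdim _ _ _ _ w).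
- exact: (@tangentially_nondegenerate_surj K n Z).
- exact: (@tangentially_nondegenerate_surj K n Z).
- exact: (@theta_iso_surj K n Z Zvar _ Tdim).
Qed.
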